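(* Let $X\in\mathbb R^{n\times n}$ and $Y\in\mathbb R^{m\times m}$ be symmetric positive definite, and equip $\mathbb R^n$ and $\mathbb R^m$ with the inner products $\langle x_1,x_2\rangle_X=x_1^\top Xx_2$ and $\langle y_1,y_2\rangle_Y=y_1^\top Yy_2$. Let $\mathbb P\in\mathcal P(\mathbb R^n)$, $A\in\mathbb R^{m\times n}$, $\varepsilon\ge0$, and let $A^\dagger$ be the Moore-Penrose inverse of $A$ with respect to these inner products. Let $c:\mathbb R^n\to\mathbb R_{\ge0}$ be a translation-invariant transportation cost (the cost of moving $x_1$ to $x_2$ being $c(x_1-x_2)$) which is orthomonotone: $c(x_1+x_2)\ge c(x_1)$ for all $x_1,x_2\in\mathbb R^n$ with $\langle x_1,x_2\rangle_X=0$. Then $$A_{\#}\mathbb B_\varepsilon^c(\mathbb P)\subset (AA^\dagger)_{\#}\mathbb B_\varepsilon^{c\circ A^\dagger}(A_{\#}\mathbb P)=A_{\#}\mathbb B_\varepsilon^{c}\big((A^\dagger A)_{\#}\mathbb P\big)\subset\mathbb B_\varepsilon^{c\circ A^\dagger}(A_{\#}\mathbb P).$$ Moreover, if $A$ has full row rank (i.e., is surjective), then all the inclusions above are equalities, and $$A_{\#}\mathbb B_\varepsilon^c(\mathbb P)=\mathbb B_\varepsilon^{c\circ A^\dagger}(A_{\#}\mathbb P).$$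
   Context: $\mathcal P(\mathbb R^n)$ is the set of Borel probability distributions on $\mathbb R^n$. For a map $f$, $(f_{\#}\mathbb P)(\mathcal A)=\mathbb P(f^{-1}(\mathcal A))$, and $f_\#S=\{f_\#\mathbb Q:\mathbb Q\in S\}$ for a set $S$ of distributions; a matrix is identified with the linear map it defines. Transportation costs are non-negative and lower semi-continuous. For a translation-invariant cost $c$ on $\mathbb R^k$, $W_c(\mathbb P,\mathbb Q)=\inf_{\gamma\in\Gamma(\mathbb P,\mathbb Q)}\int c(x_1-x_2)\,d\gamma(x_1,x_2)$, where $\Gamma(\mathbb P,\mathbb Q)$ is the set of couplings (probability distributions on $\mathbb R^k\times\mathbb R^k$ with marginals $\mathbb P,\mathbb Q$), and $\mathbb B_\varepsilon^c(\mathbb P)=\{\mathbb Q\in\mathcal P(\mathbb R^k):W_c(\mathbb P,\mathbb Q)\le\varepsilon\}$. The cost $c\circ A^\dagger$ on $\mathbb R^m$ is $(c\circ A^\dagger)(y_1-y_2)=c(A^\dagger y_1-A^\dagger y_2)$. The Moore-Penrose inverse is taken with respect to the adjoint $A^*=X^{-1}A^\top Y$; in particular $A=AA^\dagger A$, $A^\dagger=A^\dagger AA^\dagger$, and $A^\dagger A$ and $AA^\dagger$ are the orthogonal projections (in $\langle\cdot,\cdot\rangle_X$ and $\langle\cdot,\cdot\rangle_Y$) onto $\mathrm{Range}(A^* )=\mathrm{Ker}(A)^\perp$ and $\mathrm{Range}(A)$. *)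

(* Defs.v *)
From HB Require Import structures.
From mathcomp Require Import all_boot all_order all_algebra.
From mathcomp Require Import all_classical all_reals all_analysis.
From mathcomp Require Import giry.

Set Implicit Arguments.
Unset Strict Implicit.
Unset Printing Implicit Defensive.
Import Order.TTheory GRing.Theory Num.Theory.
Import numFieldNormedType.Exports.
Local Open Scope classical_set_scope.
Local Open Scope ring_scope.

Section linear_algebra.
Context {R : realType}.

Definition inner n (X : 'M[R]_n) (x1 x2 : 'cV[R]_n) : R :=
  (x1^T *m X *m x2) 0 0.

Definition sym_posdef n (X : 'M[R]_n) :=
  X^T = X /\ forall x : 'cV[R]_n, x != 0 -> 0 < inner X x x.

(* For X and Y symmetric positive definite, this is the matrix A^* such that
   inner X (A^* *m y) x = inner Y y (A *m x). *)
Definition adjmx m n (X : 'M[R]_n) (Y : 'M[R]_m) (A : 'M[R]_(m, n)) :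
  'M[R]_(n, m) := invmx X *m A^T *m Y.

Definition moore_penrose m n (X : 'M[R]_n) (Y : 'M[R]_m) (A : 'M[R]_(m, n))
    (B : 'M[R]_(n, m)) :=
  [/\ A *m B *m A = A, B *m A *m B = B,
      adjmx Y Y (A *m B) = A *m B & adjmx X X (B *m A) = B *m A].

(* The value of the choice operator is pinned down by mpinvP and
   moore_penrose_unique below. *)
Definition mpinv m n (X : 'M[R]_n) (Y : 'M[R]_m) (A : 'M[R]_(m, n)) :
  'M[R]_(n, m) := xget 0 [set B | moore_penrose X Y A B].

Lemma sym_posdef_unit n (X : 'M[R]_n) : sym_posdef X -> X \in unitmx.
Proof.
move=> [_ X0]; rewrite -row_free_unit; apply/inj_row_free => v vX.
apply/eqP; apply: contraT => v0.
have := X0 v^T; rewrite /inner trmxK vX mul0mx mxE ltxx; apply.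
by apply: contraNneq v0 => /(congr1 trmx); rewrite trmxK trmx0 => ->.
Qed.

Lemma inner_adjmx m n (X : 'M[R]_n) (Y : 'M[R]_m) (A : 'M[R]_(m, n)) x y :
  sym_posdef X -> sym_posdef Y ->
  inner X (adjmx X Y A *m y) x = inner Y y (A *m x).
Proof.
move=> sX sY; have uX := sym_posdef_unit sX; case: sX sY => [tX _] [tY _].
rewrite /inner /adjmx !trmx_mul trmx_inv trmxK tX tY !mulmxA.
by rewrite -(mulmxA _ (invmx X) X) mulVmx// mulmx1.
Qed.

Lemma sym_posdef_inv n (X : 'M[R]_n) : sym_posdef X -> sym_posdef (invmx X).
Proof.
move=> sX; have uX := sym_posdef_unit sX; case: sX => tX X0; split.
  by rewrite trmx_inv tX.
move=> x x0; have := X0 (invmx X *m x).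
rewrite /inner trmx_mul trmx_inv tX !mulmxA mulmxKV//; apply.
by apply: contraNneq x0 => h; rewrite -(mulKVmx uX x) h mulmx0.
Qed.

Lemma sym_posdef_congr n r (X : 'M[R]_n) (C : 'M[R]_(r, n)) :
  row_free C -> sym_posdef X -> sym_posdef (C *m X *m C^T).
Proof.
move=> fC [tX X0]; split; first by rewrite !trmx_mul trmxK tX mulmxA.
move=> x x0; have := X0 (C^T *m x).
rewrite /inner trmx_mul trmxK !mulmxA; apply.
apply: contraNneq x0 => /(congr1 trmx); rewrite trmx_mul trmxK trmx0 => h.
have : x^T *m C = 0 *m C by rewrite mul0mx.
by move=> /(row_free_inj fC) /(congr1 trmx); rewrite trmxK trmx0 => ->.
Qed.

Lemma moore_penrose_exists m n (X : 'M[R]_n) (Y : 'M[R]_m) (A : 'M[R]_(m, n)) :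
  sym_posdef X -> sym_posdef Y -> exists B, moore_penrose X Y A B.
Proof.
move=> sX sY; have uX := sym_posdef_unit sX; have uY := sym_posdef_unit sY.
have tX := sX.1; have tY := sY.1.
have := mulmx_base A; have := row_base_free A; have := col_base_full A.
move: (col_base A) (row_base A) => C D fC fD AE.
have sM : sym_posdef (D *m invmx X *m D^T).
  by apply: sym_posdef_congr; [exact: fD|exact: sym_posdef_inv].
have sN : sym_posdef (C^T *m Y *m C).
  have := @sym_posdef_congr _ _ Y C^T; rewrite trmxK; apply => //.
  by rewrite -row_leq_rank mxrank_tr (eqP fC).
set M := D *m invmx X *m D^T in sM; set N := C^T *m Y *m C in sN.
have uM := sym_posdef_unit sM; have uN := sym_posdef_unit sN.
pose E := invmx X *m D^T *m invmx M; pose F := invmx N *m C^T *m Y.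
have DE : D *m E = 1%:M by rewrite /E !mulmxA -/M mulmxV.
have FC : F *m C = 1%:M.
  by rewrite /F -2!mulmxA (mulmxA C^T) -/N mulVmx.
have AM k (G : 'M[R]_(n, k)) : A *m G = C *m (D *m G) by rewrite mulmxA AE.
have MA k (G : 'M[R]_(k, m)) : G *m A = G *m C *m D by rewrite -mulmxA AE.
exists (E *m F).
have AB : A *m (E *m F) = C *m F by rewrite AM (mulmxA D) DE mul1mx.
have BA : E *m F *m A = E *m D by rewrite MA -(mulmxA E) FC mulmx1.
split.
- by rewrite AB MA -(mulmxA C) FC mulmx1.
- by rewrite BA -mulmxA (mulmxA D) DE mul1mx.
- rewrite AB /adjmx /F !trmx_mul trmx_inv trmxK tY sN.1 !mulmxA.
  by rewrite mulVmx// mul1mx.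
- rewrite BA /adjmx /E !trmx_mul !trmx_inv trmxK tX sM.1 -!mulmxA.
  by rewrite mulVmx// mulmx1.
Qed.

Lemma moore_penrose_unique m n (X : 'M[R]_n) (Y : 'M[R]_m) (A : 'M[R]_(m, n))
    B B' : sym_posdef X -> sym_posdef Y ->
  moore_penrose X Y A B -> moore_penrose X Y A B' -> B = B'.
Proof.
move=> sX sY [a1 a2 a3 a4] [b1 b2 b3 b4].
have adjM k (Z : 'M[R]_k) U V : sym_posdef Z ->
    adjmx Z Z (U *m V) = adjmx Z Z V *m adjmx Z Z U.
  move=> /sym_posdef_unit uZ; rewrite /adjmx trmx_mul !mulmxA.
  by rewrite -(mulmxA _ Z (invmx Z)) mulmxV// mulmx1.
have AB : A *m B = A *m B'.
  rewrite -{1}b1 -(mulmxA _ A B) -{1}b3 -{1}a3 -adjM//.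
  by rewrite mulmxA a1 b3.
have BA : B *m A = B' *m A.
  rewrite -{1}b1 !mulmxA -(mulmxA _ B' A) -{1}b4 -{1}a4 -adjM//.
  by rewrite -mulmxA (mulmxA A) a1 b4.
by rewrite -a2 BA -mulmxA AB mulmxA b2.
Qed.

Lemma mpinvP m n (X : 'M[R]_n) (Y : 'M[R]_m) (A : 'M[R]_(m, n)) :
  sym_posdef X -> sym_posdef Y -> moore_penrose X Y A (mpinv X Y A).
Proof. by move=> sX sY; apply: xgetPex; exact: moore_penrose_exists. Qed.

End linear_algebra.

Section borel.
Context {R : realType}.

Definition borelRn (k : nat) : measurableType (@open 'cV[R]_k).-sigma :=
  g_sigma_algebraType (@open 'cV[R]_k).

Definition linmap m n (A : 'M[R]_(m, n)) (x : borelRn n) : borelRn m :=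
  (A *m (x : 'cV[R]_n) : 'cV[R]_m).

Lemma continuous_mulmx m n (A : 'M[R]_(m, n)) :
  continuous (fun x : 'cV[R]_n => A *m x).
Proof.
move=> x B [P AxP PB].
have : \forall y \near x, forall ij : 'I_m * 'I_1,
    P ij.1 ij.2 ((A *m y) ij.1 ij.2).
  apply: (@filter_forall _ _ (fun ij y => P ij.1 ij.2 ((A *m y) ij.1 ij.2)) _
    (nbhs_filter x)) => -[i j] /=.
  suff : (fun y : 'cV[R]_n => (A *m y) i j) @ x --> (A *m x) i j.
    by apply; exact: AxP.
  rewrite mxE; under eq_fun do rewrite mxE.
  apply: (cvg_big (@add_continuous R^o) (nbhs_filter x)) => k _.
  by apply: cvgMl_tmp; exact: coord_continuous.
by apply: filterS => y Py; apply: PB => i j; exact: (Py (i, j)).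
Qed.

Lemma measurable_linmap m n (A : 'M[R]_(m, n)) :
  measurable_fun [set: borelRn n] (linmap A).
Proof.
apply: (@measurability _ _ (borelRn n) (borelRn m) setT (linmap A)
  (@open 'cV[R]_m) (erefl _)).
move=> _ [B oB <-]; rewrite setTI; apply: sub_sigma_algebra.
have /continuousP := @continuous_mulmx m n A; exact.
Qed.

HB.instance Definition _ m n (A : 'M[R]_(m, n)) :=
  isMeasurableFun.Build _ _ _ _ (linmap A) (measurable_linmap A).

Definition push m n (A : 'M[R]_(m, n)) (P : probability (borelRn n) R) :
  probability (borelRn m) R := distribution P (linmap A).

(* Elements of [probability] are functions on all subsets, with unconstrained
   values on non-measurable ones, so two Leibniz-distinct elements may denote
   the same distribution.  The sets of distributions below are therefore closed
   under agreement on the Borel sets, and inclusion and equality between such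
   sets have their usual meaning. *)
Definition push_set m n (A : 'M[R]_(m, n)) (S : set (probability (borelRn n) R)) :
    set (probability (borelRn m) R) :=
  [set Q' | exists2 Q, S Q & measure_eq Q' (push A Q)].

Definition couplings k (P Q : probability (borelRn k) R) :
    set (probability (borelRn k * borelRn k)%type R) :=
  [set gamma | forall B : set (borelRn k), measurable B ->
     pushforward gamma fst B = P B /\ pushforward gamma snd B = Q B].

Definition ot_cost k (c : 'cV[R]_k -> R) (P Q : probability (borelRn k) R) :
    \bar R :=
  ereal_inf [set (\int[gamma]_z (c ((z.1 : 'cV[R]_k) - (z.2 : 'cV[R]_k)))%:E)%E
            | gamma in couplings P Q].

Definition ot_ball k (c : 'cV[R]_k -> R) (eps : R)
    (P : probability (borelRn k) R) : set (probability (borelRn k) R) :=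
  [set Q | (ot_cost c P Q <= eps%:E)%E].

(* Costs are functions of the difference; (x1, x2) |-> c (x1 - x2) is lower
   semi-continuous exactly when c is. *)
Definition transport_cost k (c : 'cV[R]_k -> R) :=
  (forall x, 0 <= c x) /\ lower_semicontinuous (EFin \o c).

Definition orthomonotone n (X : 'M[R]_n) (c : 'cV[R]_n -> R) :=
  forall x1 x2 : 'cV[R]_n, inner X x1 x2 = 0 -> c x1 <= c (x1 + x2).

End borel.

(* Main.v *)
Require Import Defs.
From HB Require Import structures.
From mathcomp Require Import all_boot all_order all_algebra.
From mathcomp Require Import all_classical all_reals all_analysis.
From mathcomp Require Import measurable_realfun giry lra.

(** The inclusions that hold for every [A] come from pushing couplings forward.
    If [gamma] couples [P] and [Q], its image by a matrix [B] on both factors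
    couples the images of [P] and [Q], and its cost does not grow if the new
    cost satisfies [c' (B x) <= c x] ([ot_cost_push_le]).  For [B = Ad] and the
    costs [c o Ad], [c] there is equality; for [B = A] and [c], [c o Ad] the
    inequality is [c (Ad A x) <= c x], which orthomonotonicity gives since
    [Ad A] is an orthogonal projection ([orthomonotone_projection]).

    For surjective [A] every [Q'] in the ball around the image of [P] must be
    lifted to some [Q] within cost [eps] of [P].  Given a coupling of [A x] and
    [y] with cost at most [eps], where [x] has law [P], one sets
    [x' = Ad y + (x - Ad A x)]: then [A x' = y] and [x - x' = Ad (A x - y)], so
    the pair [(x, x')] has the same cost ([ot_ball_lift]).  This needs two facts
    about couplings.  The infimum in the cost must be attained, as nearly
    optimal couplings would lead to different laws of [x'].  And the coupling,
    which only relates [A x] and [y], must be glued to [x].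

    Both facts follow from one construction ([ot_cost_randomized_map]).  Take
    couplings of cost at most [eps + 1/(i+1)] and their limit [m] along a free
    ultrafilter, on all measurable sets simultaneously.  A priori [m] is only
    finitely additive, but its marginals are fixed, so [E |-> m (E x F)] and
    [F |-> m (E x F)] are dominated by finite measures and thus countably
    additive ([dominated_measure]).  If the second space is embedded in the
    extended reals by [e], the Radon-Nikodym densities of
    [E |-> m (E x {e <= q})] for rational [q] form a conditional distribution
    function, and its quantile function [G], evaluated at uniform noise [u],
    satisfies that [(x, G (x, u))] has the masses of [m] on rectangles
    ([randomization]).  Thus there is a true coupling with these masses, and
    since its second component is a function of the first one and of an
    independent [u], gluing amounts to substituting [A x] for the first
    component.  An embedding of the column vectors with a measurable left
    inverse is obtained from ternary expansions ([borelRn_code]).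

    Finally the cost of this coupling is at most [eps]: its mass of an open set
    is at most the limit of the masses, because an open set is a countable union
    of rectangles ([rectangle_union_le]), and the sets [{t < c}] are open since
    [c] is lower semicontinuous ([integral_le_ultralimit]). *)

Set Implicit Arguments.
Unset Strict Implicit.
Unset Printing Implicit Defensive.
Import Order.TTheory GRing.Theory Num.Theory.
Import numFieldNormedType.Exports.
Local Open Scope classical_set_scope.
Local Open Scope ring_scope.

(** * Limits along an ultrafilter and finitely additive set functions *)

(** Ultrafilters converge on compact sets.  A free ultrafilter thus provides a
    limit of [k |-> g k A] for all sets [A] at once, which no extraction of a
    subsequence would. *)
Lemma ultra_cvg01 (R : realType) (U : set_system nat) (r : nat -> R) :
  UltraFilter U -> (forall k, 0 <= r k <= 1) -> cvg (r @ U).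
Proof.
move=> UU r01.
have PU : ProperFilter U := ultra_proper.
have : compact `[0 : R, 1]%classic by exact: segment_compact.
move=> /(_ (r @ U)) [|p [_ clp]].
  by apply: (@filterE _ U) => k /=; rewrite in_itv/=; exact: r01.
apply/cvg_ex; exists p => V /= pV.
have [//|UV] := in_ultra_setVsetC (r @^-1` V) UU.
by have [x []] := clp _ _ (UV : (r @ U) (~` V)) pV.
Qed.

Section additive_functions.
Context d (T : measurableType d) (R : realType).
Implicit Type m : set T -> R.

Definition finitely_additive m :=
  forall E F, measurable E -> measurable F -> E `&` F = set0 ->
    m (E `|` F) = m E + m F.

Lemma finitely_additive0 m : finitely_additive m -> m set0 = 0.
Proof.
move=> madd; have := madd set0 set0 measurable0 measurable0 (setI0 _).
by rewrite setU0 -[X in X = _]addr0 => /addrI.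
Qed.

Lemma finitely_additive_bigsetU m (F : nat -> set T) n :
  finitely_additive m -> (forall i, measurable (F i)) -> trivIset setT F ->
  m (\big[setU/set0]_(i < n) F i) = \sum_(i < n) m (F i).
Proof.
move=> madd mF tF; elim: n => [|n IH].
  by rewrite !big_ord0; exact: finitely_additive0.
rewrite !big_ord_recr/= -IH; apply: madd => //.
  exact: bigsetU_measurable.
by apply: (@trivIset_bigsetUI _ xpredT F _ n n) => //; apply: sub_trivIset tF.
Qed.

Lemma finitely_additiveU m E F : finitely_additive m ->
  measurable E -> measurable F -> m (E `|` F) = m E + m F - m (E `&` F).
Proof.
move=> madd mE mF.
have mFE : measurable (F `\` E) by exact: measurableD.
have -> : E `|` F = E `|` (F `\` E).
  apply/seteqP; split=> x /=; last by tauto.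
  by have [Ex|nEx] := pselect (E x); tauto.
rewrite madd// ?setDIK//.
have {2}-> : F = (E `&` F) `|` (F `\` E) by rewrite setIC setUIDK.
rewrite madd//; [lra|exact: measurableI|].
by apply/seteqP; split => x //=; tauto.
Qed.

Lemma finitely_additive_le m E F : finitely_additive m ->
  (forall E, 0 <= m E) -> measurable E -> measurable F ->
  E `<=` F -> m E <= m F.
Proof.
move=> madd m0 mE mF EF; rewrite -(setDUK EF) madd ?lerDl ?m0//.
- exact: measurableD.
- by rewrite setDIK.
Qed.

(** If [rho] dominates [m], then [rho - m] is finitely additive and nonnegative
    too, so the defect of [m] on the tail of a disjoint sequence is at most the
    one of [rho], which vanishes. *)
Lemma dominated_measure (rho : {finite_measure set T -> \bar R}) m :
  finitely_additive m -> (forall E, 0 <= m E) ->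
  (forall E, measurable E -> ((m E)%:E <= rho E)%E) ->
  exists mu : {finite_measure set T -> \bar R}, forall E, mu E = (m E)%:E.
Proof.
move=> madd m0 mrho.
pose r E := fine (rho E).
have rE E : measurable E -> rho E = (r E)%:E.
  by move=> mE; rewrite /r fineK// fin_num_measure.
have radd : finitely_additive r.
  move=> E F mE mF EF; apply: EFin_inj.
  by rewrite EFinD -!rE ?measureU//; exact: measurableU.
have dadd : finitely_additive (fun E => r E - m E).
  by move=> E F mE mF EF; rewrite radd// madd// opprD addrACA.
have d0 E : measurable E -> 0 <= r E - m E.
  by move=> mE; rewrite subr_ge0 -lee_fin -rE// mrho.
have additive : semi_sigma_additive (fun E => (m E)%:E).
  move=> F mF tF mUF.
  have subF n : \big[setU/set0]_(i < n) F i `<=` \bigcup_k F k.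
    by rewrite -bigcup_mkord; apply: bigcup_sub => i _ x; exists i.
  have mB n : measurable (\big[setU/set0]_(i < n) F i).
    by exact: bigsetU_measurable.
  have gap n : 0 <= m (\bigcup_k F k) - \sum_(i < n) m (F i) <=
      r (\bigcup_k F k) - \sum_(i < n) r (F i).
    rewrite -(finitely_additive_bigsetU n madd)//.
    rewrite -(finitely_additive_bigsetU n radd)//.
    have mD := measurableD mUF (mB n).
    rewrite -(setDUK (subF n)) radd ?madd//; [|exact: setDIK..].
    have := d0 _ mD.
    by have := m0 (\bigcup_k F k `\` \big[setU/set0]_(i < n) F i); lra.
  have rcvg : \sum_(i < n) r (F i) @[n --> \oo] --> r (\bigcup_k F k).
    have rc : (fun n => \sum_(0 <= i < n) rho (F i))%E @ \oo -->
        rho (\bigcup_n F n).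
      exact: measure_semi_sigma_additive.
    move: rc; rewrite rE// => /fine_cvg; apply: cvg_trans; apply: near_eq_cvg.
    near=> n; rewrite /= big_mkord.
    rewrite (eq_bigr (fun i : 'I_n => (r (F i))%:E)) ?sumEFin// => i _.
    exact: rE.
  under eq_fun do rewrite big_mkord sumEFin.
  apply: cvg_EFin; first by near=> n.
  rewrite /comp/=.
  have mcvg : m (\bigcup_k F k) - \sum_(i < n) m (F i) @[n --> \oo] --> (0 : R).
    apply: (@squeeze_cvgr _ _ _ _ (cst 0)
      (fun n => r (\bigcup_k F k) - \sum_(i < n) r (F i))).
    - by near=> n; exact: gap.
    - exact: cvg_cst.
    - have := cvgB (cvg_cst (r (\bigcup_k F k))) rcvg.
      by rewrite subrr; apply.
  have := cvgB (cvg_cst (m (\bigcup_k F k))) mcvg.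
  move=> /(_ _ _); rewrite subr0; apply: cvg_trans; apply: near_eq_cvg.
  by near=> n; rewrite /= fctE subKr.
pose M E := (m E)%:E.
have M0 : M set0 = 0%E by rewrite /M finitely_additive0.
have Mge0 E : (0 <= M E)%E by rewrite lee_fin.
have Mfin : fin_num_fun M by move=> E mE.
pose mu0 : {measure set T -> \bar R} :=
  HB.pack M (isMeasure.Build _ _ _ M M0 Mge0 additive).
pose mu1 := Measure_isFinite.Build _ _ _ mu0 Mfin.
pose mu : {finite_measure set T -> \bar R} := HB.pack M mu0 mu1.
by exists mu.
Unshelve. all: by end_near. Qed.

End additive_functions.

(** * Measurability and countable unions *)

Lemma measurable_preimage d d' (T : measurableType d) (S : measurableType d')
    (f : T -> S) B :
  measurable_fun setT f -> measurable B -> measurable (f @^-1` B).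
Proof. by move=> mf mB; rewrite -[X in measurable X]setTI; exact: mf. Qed.

Lemma measurable_set_ltr d (T : measurableType d) (R : realType)
    (f g : T -> R) :
  measurable_fun setT f -> measurable_fun setT g ->
  measurable [set x | f x < g x].
Proof.
move=> mf mg; have mfg := measurable_fun_ltr mf mg.
exact: (measurable_preimage mfg (_ : measurable [set true])).
Qed.

Lemma bigcup_countE (I : countType) (T : Type) (F : I -> set T) :
  \bigcup_i F i = \bigcup_k (if unpickle k is Some i then F i else set0).
Proof.
apply/seteqP; split => [x [i _ Fix]|x [k _]].
  by exists (pickle i) => //; rewrite pickleK.
by case: unpickle => // i Fix; exists i.
Qed.

Lemma measure0_bigcup_count d (T : measurableType d) (R : realType)
    (mu : {measure set T -> \bar R}) (I : countType) (F : I -> set T) :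
  (forall i, measurable (F i)) -> (forall i, mu (F i) = 0%E) ->
  mu (\bigcup_i F i) = 0%E.
Proof.
move=> mF F0; apply: measure_negligible.
  exact: countable_bigcupT_measurable.
rewrite bigcup_countE; apply: negligible_bigcup => k.
case: unpickle => [i|]; last exact: negligible_set0.
by exists (F i); split.
Qed.

(** * Monotone families of densities *)

Section densities.
Context d (T : measurableType d) (R : realType).
Variable mu : {finite_measure set T -> \bar R}.

(** On the set where [g < f], the nonnegative function [f - g] has a nonpositive
    integral. *)
Lemma density_le_ae (f g : T -> R) :
  mu.-integrable setT (EFin \o f) -> mu.-integrable setT (EFin \o g) ->
  (forall E, measurable E ->
    \int[mu]_(x in E) (f x)%:E <= \int[mu]_(x in E) (g x)%:E)%E ->
  measurable [set x | g x < f x] /\ mu [set x | g x < f x] = 0%E.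
Proof.
move=> If Ig fg.
have mf : measurable_fun setT f by apply/measurable_EFinP; case/integrableP: If.
have mg : measurable_fun setT g by apply/measurable_EFinP; case/integrableP: Ig.
set E := [set x | g x < f x].
have mE : measurable E by exact: measurable_set_ltr.
split => //.
have IfE : mu.-integrable E (EFin \o f) by exact: integrableS If.
have IgE : mu.-integrable E (EFin \o g) by exact: integrableS Ig.
have mfg : measurable_fun E (fun x => (f x - g x)%:E).
  by apply/measurable_EFinP; apply: measurable_funTS; exact: measurable_funB.
have : (\int[mu]_(x in E) `|(f x - g x)%:E| = 0)%E.
  apply/eqP; rewrite eq_le integral_ge0// andbT.
  rewrite (eq_integral (fun x => (f x)%:E - (g x)%:E)%E); last first.
    by move=> x /[!inE] /= Ex; rewrite ger0_norm// subr_ge0 ltW.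
  by rewrite integralB_EFin// leeBlDl ?integrable_fin_num// addr0 fg.
move=> /(ae_eq_integral_abs mu mE mfg) [N [mN N0 EN]].
apply: (subset_measure0 mE mN _ N0) => x Ex; apply: EN => /= /(_ Ex).
by case=> fgx; move: Ex; rewrite /E/= -subr_gt0 fgx ltxx.
Qed.

(** Radon-Nikodym densities are ordered only almost everywhere.  There are
    countably many indices, so all the exceptional sets lie in one null set,
    on which the densities are replaced by 0: the order and the bounds then
    hold everywhere. *)
Lemma monotone_densities (nu : rat -> {finite_measure set T -> \bar R}) :
  (forall (q r : rat) E, measurable E -> q <= r -> (nu q E <= nu r E)%E) ->
  (forall q E, measurable E -> (nu q E <= mu E)%E) ->
  exists f : rat -> T -> R,
    [/\ forall q, measurable_fun setT (f q),
        forall q x, 0 <= f q x <= 1,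
        forall (q r : rat) x, q <= r -> f q x <= f r x &
        forall q E, measurable E -> nu q E = (\int[mu]_(x in E) (f q x)%:E)%E].
Proof.
move=> nu_nd nu_le.
have /choice[f0 f0P] q : exists f : T -> R, [/\ forall x, 0 <= f x,
    mu.-integrable setT (EFin \o f) &
    forall E, measurable E -> nu q E = (\int[mu]_(x in E) (f x)%:E)%E].
  have nuq : nu q `<< mu.
    apply/null_content_dominatesP => E mE E0; apply/eqP.
    by rewrite eq_le measure_ge0 andbT -E0 nu_le.
  have [f [f_ge0 ffin If fE]] := radon_nikodym_sigma_finite nuq.
  have fK : EFin \o (fine \o f) = f by apply/funext => x /=; rewrite fineK.
  exists (fine \o f); split => [x||E mE]; first exact: fine_ge0.
    by rewrite fK.
  by rewrite fE// -[in LHS]fK.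
have mf q : measurable_fun setT (f0 q).
  by have [_ /integrableP[/measurable_EFinP]] := f0P q.
pose B (p : rat * rat) := if p.1 <= p.2
  then [set x | f0 p.2 x < f0 p.1 x] `|` [set x | 1 < f0 p.1 x] else set0.
have BP p : measurable (B p) /\ mu (B p) = 0%E.
  rewrite /B; case: p => q r /=; case: ifP => // qr.
  have [m1 n1] : measurable [set x | f0 r x < f0 q x] /\
      mu [set x | f0 r x < f0 q x] = 0%E.
    have [_ I1 E1] := f0P q; have [_ I2 E2] := f0P r.
    by apply: density_le_ae => // E mE; rewrite -E1// -E2// nu_nd.
  have [m2 n2] : measurable [set x | 1 < f0 q x] /\
      mu [set x | 1 < f0 q x] = 0%E.
    have [_ I1 E1] := f0P q.
    apply: (density_le_ae I1 (g := cst 1)) => [|E mE].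
      exact: finite_measure_integrable_cst.
    by rewrite -E1//= (integral_cst mu mE) mul1e nu_le.
  split; first exact: measurableU.
  by rewrite measureU0.
pose N := \bigcup_p B p.
have mN : measurable N.
  by apply: countable_bigcupT_measurable => // p; have [] := BP p.
have N0 : mu N = 0%E by apply: measure0_bigcup_count => p; have [] := BP p.
have NP x : ~ N x -> forall q r, q <= r -> f0 q x <= f0 r x /\ f0 q x <= 1.
  move=> Nx q r qr; rewrite !leNgt; split; apply/negP => h; apply: Nx.
  - by exists (q, r) => //; rewrite /B/= qr; left.
  - by exists (q, r) => //; rewrite /B/= qr; right.
pose f q x := f0 q x * \1_(~` N) x.
have fN q x : ~ N x -> f q x = f0 q x.
  by move=> Nx; rewrite /f indicE mem_set// mulr1.
have f_0 q x : N x -> f q x = 0.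
  by move=> Nx; rewrite /f indicE memNset ?mulr0//=; apply.
have mfq q : measurable_fun setT (f q).
  by apply: measurable_funM => //; apply: measurable_indic; exact: measurableC.
exists f; split => //.
- move=> q x; have [Nx|Nx] := pselect (N x); first by rewrite f_0// lexx ler01.
  by rewrite fN//; have [-> _ _] := f0P q; have [_ ->] := NP _ Nx q q (lexx _).
- move=> q r x qr; have [Nx|Nx] := pselect (N x); first by rewrite !f_0.
  by rewrite !fN//; have [] := NP _ Nx q r qr.
- move=> q E mE; have [f0q _ ->//] := f0P q.
  apply: ge0_ae_eq_integral => //.
  + by apply/measurable_EFinP; exact: measurable_funTS.
  + by apply/measurable_EFinP; exact: measurable_funTS.
  + by move=> x _; rewrite lee_fin.
  + by move=> x _; rewrite lee_fin mulr_ge0// indicE.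
  + exists N; split => // x /= Nfx; apply: contrapT => Nx.
    by apply: Nfx => _; rewrite fN.
Qed.

End densities.

(** * Increasing families of sets indexed by the rationals *)

Section rational_chains.
Variable R : realType.

Lemma rat_enum : exists e : nat -> rat, forall q, exists n, e n = q.
Proof.
exists (fun n => odflt 0 (unpickle n)) => q; exists (pickle q).
by rewrite pickleK.
Qed.

Lemma rat_seq_below (t : R) : exists r : nat -> rat,
  [/\ nondecreasing_seq r, forall n, ratr (r n) < t &
      forall q, ratr q < t -> exists n, q <= r n].
Proof.
have [q0 /itvP q0t] : exists q : rat, ratr q \in `]t - 1, t[.
  by apply: rat_in_itvoo; rewrite ltrBlDr ltrDl.
have [e eP] := rat_enum.
pose r := fix r n := if n is k.+1 then
  if ratr (e k) < t then Num.max (r k) (e k) else r k else q0.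
exists r; split.
- by apply/nondecreasing_seqP => n /=; case: ifP; rewrite ?le_max ?lexx.
- elim=> [|n IH] /=; first by rewrite q0t.
  by case: ifP => // en; rewrite maxEle; case: ifP.
- move=> q qt; have [n en] := eP q; exists n.+1 => /=.
  by rewrite en qt le_max lexx orbT.
Qed.

(** The union over [q < t] is the union of an increasing sequence of members of
    the family, so continuity from below applies on both sides along the same
    indices. *)
Lemma measure_rat_chain_eq d d' (T : measurableType d) (T' : measurableType d')
    (mu : {measure set T -> \bar R}) (mu' : {measure set T' -> \bar R})
    (D : rat -> set T) (D' : rat -> set T') (t : R) :
  (forall q, measurable (D q)) -> (forall q, measurable (D' q)) ->
  (forall q r : rat, q <= r -> D q `<=` D r) ->
  (forall q r : rat, q <= r -> D' q `<=` D' r) ->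
  (forall q, mu (D q) = mu' (D' q)) ->
  mu (\bigcup_(q in [set q | ratr q < t]) D q) =
  mu' (\bigcup_(q in [set q | ratr q < t]) D' q).
Proof.
move=> mD mD' ndD ndD' DD'; have [r [ndr rt rP]] := rat_seq_below t.
have rU (T0 : Type) (F : rat -> set T0) :
    (forall q r : rat, q <= r -> F q `<=` F r) ->
    \bigcup_(q in [set q | ratr q < t]) F q = \bigcup_n F (r n).
  move=> ndF; apply/seteqP; split => [x [q /rP[n qn] Fx]|x [n _ Fx]].
    by exists n => //; exact: ndF Fx.
  by exists (r n) => //; exact: rt.
rewrite !rU//.
have cvgD : mu (D (r n)) @[n --> \oo] --> mu (\bigcup_n D (r n)).
  apply: (@nondecreasing_cvg_mu _ _ _ mu (D \o r)) => //.
  - by move=> n; exact: mD.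
  - by apply: bigcupT_measurable => n; exact: mD.
  - by move=> m n mn; apply/subsetPset; apply: ndD; exact: ndr.
have cvgD' : mu' (D' (r n)) @[n --> \oo] --> mu' (\bigcup_n D' (r n)).
  apply: (@nondecreasing_cvg_mu _ _ _ mu' (D' \o r)) => //.
  - by move=> n; exact: mD'.
  - by apply: bigcupT_measurable => n; exact: mD'.
  - by move=> m n mn; apply/subsetPset; apply: ndD'; exact: ndr.
move: cvgD; under eq_fun do rewrite DD'.
by move=> cvgD; exact: cvg_unique cvgD cvgD'.
Qed.

End rational_chains.

(** * Uniform noise *)

Section uniform_noise.
Context d (T : measurableType d) (R : realType).
Variable P : probability T R.

Definition unif01 : probability (measurableTypeR R) R :=
  uniform_prob (@ltr01 R).

Lemma unif01_ray (a : R) : 0 <= a <= 1 -> unif01 `]-oo, a]%classic = a%:E.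
Proof.
move=> /andP[a0 a1].
rewrite /unif01/= /uniform_prob integral_uniform_pdf.
have -> : `]-oo, a]%classic `&` `[0, 1]%classic = `[0, a]%classic :> set R.
  apply/seteqP; split => x /=; rewrite !in_itv/=; first by case=> -> /andP[->].
  by move=> /andP[-> xa]; rewrite xa (le_trans xa a1).
rewrite (eq_integral (cst 1%:E)).
  rewrite integral_cst//= mul1e lebesgue_measure_itv/= lte_fin sube0.
  by case: ltgtP a0 => // <-.
move=> x; rewrite inE/= in_itv/= => /andP[x0 xa].
by rewrite /uniform_pdf x0 (le_trans xa a1) subr0 invr1.
Qed.

Lemma measurable_subgraph (f : T -> R) E :
  measurable_fun setT f -> measurable E ->
  measurable ([set z : T * measurableTypeR R | E z.1 /\ z.2 <= f z.1]).
Proof.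
move=> mf mE.
have -> : [set z : T * measurableTypeR R | E z.1 /\ z.2 <= f z.1] =
    (fst @^-1` E) `&` [set z | z.2 <= f z.1] by [].
apply: measurableI; first exact: measurable_preimage measurable_fst mE.
have mle := measurable_fun_ler measurable_snd
  (measurableT_comp mf measurable_fst).
exact: (measurable_preimage mle (_ : measurable [set true])).
Qed.

Lemma measure_subgraph (f : T -> R) E :
  measurable_fun setT f -> (forall x, 0 <= f x <= 1) -> measurable E ->
  (P \x unif01)%E [set z | E z.1 /\ z.2 <= f z.1] =
  (\int[P]_(x in E) (f x)%:E)%E.
Proof.
move=> mf f01 mE; rewrite /product_measure1 [RHS]integral_mkcond.
apply: eq_integral => x _ /=; rewrite patchE.
case: ifPn => xE.
  rewrite -unif01_ray//; congr (_ _).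
  apply/seteqP; split => u; rewrite /xsection/= inE/= in_itv/=; first by case.
  by move: xE; rewrite inE.
rewrite (_ : xsection _ _ = set0) ?measure0//.
apply/seteqP; split => u //; rewrite /xsection/= inE/= => -[Ex].
by move: xE; rewrite notin_setE.
Qed.

End uniform_noise.

(** * Realizing a finitely additive coupling by a randomized map *)

Lemma pushforward_is_measure d d' (T : measurableType d) (S : measurableType d')
    (R : realType) (mu : {measure set T -> \bar R}) (f : T -> S) :
  measurable_fun setT f ->
  exists nu : {measure set S -> \bar R}, forall A, nu A = mu (f @^-1` A).
Proof.
move=> mf.
by exists
  (measure_function_pushforward__canonical__measure_function_Measure mu mf).
Qed.

Lemma measure_eq_ereal_rays (R : realType)
    (mu nu : {measure set \bar R -> \bar R}) :
  (mu setT < +oo)%E -> mu setT = nu setT ->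
  (forall t : R, mu `]-oo, t%:E[%classic = nu `]-oo, t%:E[%classic) ->
  forall B, measurable B -> mu B = nu B.
Proof.
move=> muoo munuT munu.
apply: (measure_unique (setT |` @ErealGenInftyO.G R) (fun=> setT)) => //.
- rewrite [LHS]ErealGenInftyO.measurableE; apply/seteqP; split.
    apply: smallest_sub; first exact: smallest_sigma_algebra.
    by move=> A GA; apply: sub_sigma_algebra; right.
  apply: smallest_sub; first exact: smallest_sigma_algebra.
  move=> A [->|GA]; last exact: sub_sigma_algebra.
  exact: (@measurableT _ (g_sigma_algebraType (@ErealGenInftyO.G R))).
- move=> A B [->|[s ->]] [->|[t ->]]; rewrite ?setTI ?setIT.
  + by left.
  + by right; exists t.
  + by right; exists s.
  + right; exists (Num.min s t).
    by apply/seteqP; split => x /=; rewrite !in_itv/= EFin_min lt_min => /andP.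
- by left.
- by apply/seteqP; split => // x _; exists 0%N.
- by move=> A [->|[t ->]].
Qed.

Section randomization.
Context d d' (T : measurableType d) (S : measurableType d') (R : realType).
Variables (P : probability T R) (Q : probability S R).

(** What survives of a sequence of couplings of [P] and [Q] in the limit along
    an ultrafilter: the marginals are countably additive, the joint law need
    not be. *)
Record finitely_additive_coupling (m : set T -> set S -> R) : Prop := {
  fac_ge0 : forall E F, 0 <= m E F;
  fac_left : forall F, measurable F -> finitely_additive (m ^~ F);
  fac_right : forall E, measurable E -> finitely_additive (m E);
  fac_fst : forall E, measurable E -> (m E setT)%:E = P E;
  fac_snd : forall F, measurable F -> (m setT F)%:E = Q F }.

Variable m : set T -> set S -> R.
Hypothesis mfac : finitely_additive_coupling m.

Lemma fac_le_fst E F : measurable E -> measurable F -> ((m E F)%:E <= P E)%E.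
Proof.
move=> mE mF; rewrite -(fac_fst mfac)// lee_fin.
apply: (finitely_additive_le (fac_right mfac mE)) => // F'.
exact: fac_ge0 mfac _ _.
Qed.

Lemma fac_le_snd E F : measurable E -> measurable F -> ((m E F)%:E <= Q F)%E.
Proof.
move=> mE mF; rewrite -(fac_snd mfac)// lee_fin.
apply: (finitely_additive_le (fac_left mfac mF)) => // F'.
exact: fac_ge0 mfac _ _.
Qed.

(** For fixed [F], [m ^~ F] is a measure dominated by [P]; its densities for the
    sets [F = {e <= q}] form a conditional distribution function, whose quantile
    function fed with uniform noise is the map.  For fixed [E], [m E] is a
    measure dominated by [Q], hence it is enough to compare the two sides on
    rays. *)
Lemma randomization_ereal (e : S -> \bar R) : measurable_fun setT e ->
  exists2 G : T * measurableTypeR R -> \bar R, measurable_fun setT G &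
    forall E B, measurable E -> measurable B ->
      (P \x unif01 R)%E [set z | E z.1 /\ B (G z)] = (m E (e @^-1` B))%:E.
Proof.
move=> me.
pose H (q : rat) := e @^-1` [set x | x <= (ratr q)%:E]%E.
have mH q : measurable (H q).
  apply: measurable_preimage => //.
  rewrite [X in measurable X](_ : _ = `]-oo, (ratr q)%:E]%classic).
    exact: emeasurable_itv.
  by apply/seteqP; split => x /=; rewrite in_itv.
have ndH (q r : rat) : q <= r -> H q `<=` H r.
  by move=> qr y /le_trans; apply; rewrite lee_fin ler_rat.
have /choice[nu nuE] q : exists mu : {finite_measure set T -> \bar R},
    forall E, mu E = (m E (H q))%:E.
  apply: (@dominated_measure _ _ _ P (m ^~ (H q))).
  - exact: fac_left mfac _ (mH q).
  - by move=> E; exact: fac_ge0 mfac _ _.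
  - by move=> E mE; exact: fac_le_fst.
have [f [mf f01 ndf fE]] : exists f : rat -> T -> R,
    [/\ forall q, measurable_fun setT (f q),
        forall q x, 0 <= f q x <= 1,
        forall (q r : rat) x, q <= r -> f q x <= f r x &
        forall q E, measurable E -> nu q E = (\int[P]_(x in E) (f q x)%:E)%E].
  apply: monotone_densities => [q r E mE qr|q E mE]; rewrite !nuE.
    rewrite lee_fin; apply: (finitely_additive_le (fac_right mfac mE)) => //.
      by move=> F; exact: fac_ge0 mfac _ _.
    exact: ndH.
  exact: fac_le_fst.
pose D E q := [set z : T * measurableTypeR R | E z.1 /\ z.2 <= f q z.1].
have mD E q : measurable E -> measurable (D E q).
  by move=> mE; exact: measurable_subgraph.
(* [q |-> f q x] is the conditional distribution function of the second
   coordinate, and [G (x, .)] its quantile function *)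
pose G (z : T * measurableTypeR R) :=
  ereal_inf [set (ratr q : R)%:E | q in [set q | z.2 <= f q z.1]].
have GlE (t : R) : G @^-1` `]-oo, t%:E[%classic =
    \bigcup_(q in [set q | ratr q < t]) D setT q.
  apply/seteqP; split => [z|z [q qt [_ zq]]]; rewrite /= in_itv/=.
    by move=> /ereal_inf_lt[_ [q /= zq <-]]; rewrite lte_fin => qt; exists q.
  apply: (@le_lt_trans _ _ (ratr q)%:E); last by rewrite lte_fin.
  by apply: ereal_inf_lbound; exists q.
have mG : measurable_fun setT G.
  apply: (measurability (@ErealGenInftyO.G R)).
    exact: ErealGenInftyO.measurableE.
  move=> _ [_ [t ->] <-]; rewrite setTI GlE bigcup_mkcond.
  apply: countable_bigcupT_measurable => // q; case: ifP => // _.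
  exact: mD.
exists G => // E B mE mB.
have [nuF nuFE] : exists mu : {finite_measure set S -> \bar R},
    forall F, mu F = (m E F)%:E.
  apply: (@dominated_measure _ _ _ Q (m E)).
  - exact: fac_right.
  - by move=> F; exact: fac_ge0 mfac _ _.
  - by move=> F mF; exact: fac_le_snd.
have mE1 : measurable (fst @^-1` E : set (T * measurableTypeR R)).
  exact: measurable_preimage measurable_fst mE.
have [mu1 mu1E] := pushforward_is_measure (mrestr (P \x unif01 R)%E mE1) mG.
have [mu2 mu2E] := pushforward_is_measure nuF me.
have {}mu2E A : mu2 A = (m E (e @^-1` A))%:E by rewrite mu2E; exact: nuFE.
have {}mu1E A : mu1 A = (P \x unif01 R)%E [set z | E z.1 /\ A (G z)].
  have -> : [set z | E z.1 /\ A (G z)] = G @^-1` A `&` fst @^-1` E.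
    by apply/seteqP; split => z /= [? ?]; split.
  exact: mu1E.
rewrite -mu1E -mu2E.
have muT : mu1 setT = mu2 setT.
  rewrite mu1E mu2E preimage_setT (fac_fst mfac)//.
  rewrite (_ : [set _ | _] = E `*` setT); last by apply/seteqP; split => z [].
  rewrite product_measure1E// -[RHS]mule1; congr (_ * _)%E.
  exact: probability_setT.
apply: measure_eq_ereal_rays => //.
- by rewrite muT mu2E ltry.
- move=> t; rewrite mu1E mu2E -nuFE.
  transitivity ((P \x unif01 R)%E (\bigcup_(q in [set q | ratr q < t]) D E q)).
    congr (_ _); apply/seteqP; split => z /=.
      move=> [Ez Gz].
      have : (G @^-1` `]-oo, t%:E[%classic) z by [].
      by rewrite GlE => -[q qt [_ zq]]; exists q.
    move=> [q qt [Ez zq]]; split => //.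
    suff : (G @^-1` `]-oo, t%:E[%classic) z by [].
    by rewrite GlE; exists q.
  rewrite (@measure_rat_chain_eq _ _ _ _ _ _ nuF (D E) H) //.
  + congr (nuF _); apply/seteqP; split => [y [q /= qt Hqy]|y].
      by rewrite in_itv/=; apply: le_lt_trans Hqy _; rewrite lte_fin.
    rewrite /= in_itv/= => yt.
    suff [q qt yq] : exists2 q : rat, ratr q < t & (e y <= (ratr q)%:E)%E.
      by exists q.
    move: yt; case: (e y) => [s|yt|_]; last 2 first.
      by have := lt_trans yt (ltry t); rewrite ltxx.
      by have [r [_ rt _]] := rat_seq_below t; exists (r 0%N); rewrite ?leNye.
    rewrite lte_fin => /rat_in_itvoo[q]; rewrite in_itv/= => /andP[sq qt].
    by exists q; rewrite ?lee_fin ?ltW.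
  + by move=> q; exact: mD.
  + by move=> q r qr z [Ez zq]; split => //; exact: le_trans zq (ndf _ _ _ qr).
  + move=> q; apply: etrans (measure_subgraph P (mf q) (f01 q) mE) _.
    by rewrite -fE// nuE; exact/esym/nuFE.
Qed.

(** Transfer to a space that embeds in the extended reals with a measurable left
    inverse. *)
Lemma randomization (e : S -> \bar R) (dec : \bar R -> S) :
  measurable_fun setT e -> measurable_fun setT dec -> cancel e dec ->
  exists2 G : T * measurableTypeR R -> S, measurable_fun setT G &
    forall E F, measurable E -> measurable F ->
      (P \x unif01 R)%E [set z | E z.1 /\ F (G z)] = (m E F)%:E.
Proof.
move=> me mdec eK; have [G mG GE] := randomization_ereal me.
exists (dec \o G); first exact: measurableT_comp.
move=> E F mE mF; have mdF : measurable (dec @^-1` F).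
  exact: measurable_preimage.
rewrite (GE E (dec @^-1` F))// -comp_preimage.
by congr (m E _)%:E; apply/seteqP; split => y /=; rewrite eK.
Qed.

End randomization.

(** * Coding countably many sets by one ternary expansion *)

Section ternary_code.
Variable R : realType.
Implicit Type a : nat -> bool.

(** Digits 0 and 1 in base 3: the tail after a digit is at most 1/2, so the
    first digit is 1 exactly when the sum is at least 1. *)
Definition ternary a : \bar R := (\sum_(i <oo) ((a i)%:R * 3^-1 ^+ i)%:E)%E.

Lemma ternary_term_ge0 a i : (0 <= ((a i)%:R * 3^-1 ^+ i : R)%:E)%E.
Proof. by rewrite lee_fin mulr_ge0// exprn_ge0. Qed.

Lemma ternary_ge0 a : (0 <= ternary a)%E.
Proof. by apply: nneseries_ge0 => i _ _; exact: ternary_term_ge0. Qed.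

Lemma ternary_le a : (ternary a <= (3 / 2 : R)%:E)%E.
Proof.
apply: lime_le.
  by apply: is_cvg_nneseries => i _ _; exact: ternary_term_ge0.
apply: nearW => n; rewrite big_mkord sumEFin lee_fin.
apply: (@le_trans _ _ (3 / 2 * (1 - 3^-1 ^+ n))); last first.
  have : 0 <= 3^-1 ^+ n :> R by rewrite exprn_ge0.
  by move: (_ ^+ n) => x; lra.
(* the partial sums are bounded by those of the expansion 1.111... *)
elim: n => [|n IH]; first by rewrite big_ord0 expr0 subrr mulr0.
rewrite big_ord_recr/= exprSr.
have : (a n)%:R * 3^-1 ^+ n <= 3^-1 ^+ n :> R.
  by rewrite ler_piMl ?exprn_ge0//; case: (a n).
by move=> h; apply: le_trans (lerD IH h) _; move: (3^-1 ^+ n) => x; lra.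
Qed.

Lemma ternary_fin_num a : ternary a \is a fin_num.
Proof.
by rewrite ge0_fin_numE ?ternary_ge0// (le_lt_trans (ternary_le a)) ?ltry.
Qed.

Lemma ternary_rec a :
  fine (ternary a) = (a 0%N)%:R + 3^-1 * fine (ternary (fun i => a i.+1)).
Proof.
apply: EFin_inj; rewrite EFinD EFinM !fineK ?ternary_fin_num// /ternary.
rewrite nneseries_recl//.
rewrite expr0 mulr1 -nneseriesZl; last first.
  by move=> i _; exact: (ternary_term_ge0 (fun i => a i.+1)).
congr (_ + _)%E.
rewrite -[LHS](@nneseries_addn R
  (fun i => ((a i)%:R * 3^-1 ^+ i)%:E) 1%N); last first.
  by move=> i; exact: ternary_term_ge0.
by apply: eq_eseriesr => i _; rewrite addn1 -EFinM exprS mulrCA.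
Qed.

Definition ternary_shift (x : R) : R := 3 * (x - (1 <= x)%R%:R).

Lemma ternary_head a : (1 <= fine (ternary a)) = a 0%N.
Proof.
have := ternary_ge0 (fun i => a i.+1); have := ternary_le (fun i => a i.+1).
rewrite ternary_rec -(fineK (ternary_fin_num (fun i => a i.+1))) !lee_fin.
case: (a 0%N) => /= h1 h2; first by rewrite lerDl mulr_ge0.
by apply/negbTE; rewrite -ltNge; lra.
Qed.

Lemma ternary_shiftE a k :
  iter k ternary_shift (fine (ternary a)) =
  fine (ternary (fun i => a (k + i)%N)).
Proof.
elim: k => [//|k IH] /=; rewrite IH /ternary_shift ternary_head.
rewrite ternary_rec addn0 addrAC subrr add0r mulrA divff// mul1r.
by congr (fine (ternary _)); apply/funext => i; rewrite addnS.
Qed.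

Lemma measurable_ternary_shift : measurable_fun setT ternary_shift.
Proof.
apply: measurable_funM => //; apply: measurable_funB => //.
have -> : (fun x : R => (1 <= x)%R%:R) = \1_`[1 : R, +oo[%classic :> (R -> R).
  apply/funext => x; rewrite indicE; congr (_%:R).
  by rewrite mem_setE in_itv/= andbT.
exact: measurable_indic.
Qed.

(** The code of [y] is the expansion whose digits say which of the sets [F i]
    contain [y]; a digit is read off by shifting. *)
Lemma measurable_family_code d (T : measurableType d) (F : nat -> set T) :
  (forall i, measurable (F i)) ->
  exists (e : T -> \bar R) (W : nat -> set (\bar R)),
    [/\ measurable_fun setT e, forall i, measurable (W i) &
        forall i, e @^-1` (W i) = F i].
Proof.
move=> mF; pose a y i := y \in F i.
exists (fun y => ternary (a y)).
exists (fun k => [set x | 1 <= iter k ternary_shift (fine x)]); split.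
- apply: (@ge0_emeasurable_sum _ T R setT
    (fun i y => ((a y i)%:R * 3^-1 ^+ i)%:E) xpredT) => [k y _ _|k _].
    exact: ternary_term_ge0.
  apply/measurable_EFinP; apply: measurable_funM => //.
  rewrite (_ : (fun y => _) = \1_(F k)); first exact: measurable_indic.
  by apply/funext => y; rewrite indicE.
- move=> k; have mk : measurable_fun setT
      (fun x : \bar R => iter k ternary_shift (fine x)).
    elim: k => [|k IH]; first exact: fine_measurable.
    exact: (measurableT_comp measurable_ternary_shift IH).
  have mle := measurable_fun_ler (measurable_cst (1 : R)) mk.
  exact: (measurable_preimage mle (_ : measurable [set true])).
- move=> k; apply/seteqP; split => y /=.
    by rewrite ternary_shiftE ternary_head addn0 /a inE.
  by rewrite ternary_shiftE ternary_head addn0 /a inE.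
Qed.

End ternary_code.

(** * Borel sets of column vectors *)

Section borel_boxes.
Context {R : realType}.
Implicit Types k : nat.

Definition rat_box k (p : 'cV[rat]_k * nat) : set (borelRn (R := R) k) :=
  [set x | forall i, `|x i 0 - ratr (p.1 i 0)| < p.2.+1%:R^-1].

Lemma rat_box_nbhs k (x : 'cV[R]_k) (e : R) : 0 < e ->
  exists p, rat_box p x /\ rat_box p `<=` ball x e.
Proof.
move=> e0.
have [n _ ne] : exists2 n : nat, True & n.+1%:R^-1 < e / 2.
  have [n] := ltr_add_invr (divr_gt0 e0 (@ltr0n R 2)).
  by rewrite add0r => ?; exists n.
have /choice[q qP] (i : 'I_k) : exists r : rat, `|x i 0 - ratr r| < n.+1%:R^-1.
  have [|r] := @rat_in_itvoo R (x i 0 - n.+1%:R^-1) (x i 0 + n.+1%:R^-1).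
    by rewrite ltrBlDr -addrA ltrDl addr_gt0// invr_gt0.
  by rewrite in_itv/= => rP; exists r; rewrite distrC ltr_distl.
exists (\col_i q i, n); split => [i|y yP]; first by rewrite mxE.
split => // i j; rewrite ord1 /ball/=.
have := yP i; have := qP i; rewrite /= mxE => h1 h2.
rewrite (_ : _ - _ = (x i 0 - ratr (q i)) - (y i 0 - ratr (q i))); last first.
  by rewrite opprB addrA subrK.
apply: le_lt_trans (ler_normB _ _) _; rewrite [e]splitr.
by apply: ltrD; [exact: lt_trans h1 ne|exact: lt_trans h2 ne].
Qed.

Lemma open_rat_boxE k (O : set 'cV[R]_k) : open O ->
  O = \bigcup_(p in [set p | rat_box p `<=` O]) rat_box p.
Proof.
move=> oO; apply/seteqP; split => [x Ox|x [p pO]]; last exact: pO.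
have : O° x by move: oO; rewrite openE; exact.
move=> /nbhs_ballP[e /= e0 eO]; have [p [px pe]] := rat_box_nbhs x e0.
by exists p => //=; apply: subset_trans eO.
Qed.

Lemma open_rat_box2E j k (O : set ('cV[R]_j * 'cV[R]_k)) : open O ->
  O = \bigcup_(p in [set p | rat_box p.1 `*` rat_box p.2 `<=` O])
        (rat_box p.1 `*` rat_box p.2).
Proof.
move=> oO; apply/seteqP; split => [[x y] Oxy|x [p pO]]; last exact: pO.
have : O° (x, y) by move: oO; rewrite openE; exact.
move=> /nbhs_ballP[e /= e0 eO].
have [p [px pe]] := rat_box_nbhs x e0; have [q [qy qe]] := rat_box_nbhs y e0.
exists (p, q) => //=; apply: subset_trans eO => -[x' y'] [/= px' qy'].
by split; [exact: pe|exact: qe].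
Qed.

Lemma continuous_borelRn k (f : 'cV[R]_k -> R) :
  continuous f -> measurable_fun setT (f : borelRn k -> R).
Proof.
move=> /continuousP cf.
apply: (@measurability _ _ (borelRn k) R setT f (@RGenOpens.G R)).
  exact: RGenOpens.measurableE.
move=> _ [_ [a [b ->]] <-]; rewrite setTI; apply: sub_sigma_algebra.
by apply: cf; exact: interval_open.
Qed.

Lemma measurable_coord k i :
  measurable_fun setT (fun x : borelRn k => (x : 'cV[R]_k) i 0).
Proof. by apply: continuous_borelRn => x; exact: coord_continuous. Qed.

Lemma measurable_preimage_rat_box d (T : measurableType d) k
    (f : T -> borelRn k) (p : 'cV[rat]_k * nat) :
  (forall i, measurable_fun setT (fun t => (f t : 'cV[R]_k) i 0)) ->
  measurable (f @^-1` rat_box p).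
Proof.
move=> mf.
have -> : f @^-1` rat_box p = \bigcap_(i in [set: 'I_k])
    (fun t => (f t : 'cV[R]_k) i 0) @^-1`
      ball (ratr (p.1 i 0) : R) (p.2.+1%:R^-1).
  apply/seteqP; split => t /= h i.
    by move=> _; rewrite /ball/= distrC; exact: h.
  by have := h i I; rewrite /ball/= distrC.
apply: fin_bigcap_measurable => // i _.
by apply: measurable_preimage => //; exact: measurable_ball.
Qed.

Lemma measurable_rat_box k (p : 'cV[rat]_k * nat) : measurable (rat_box p).
Proof.
exact: (measurable_preimage_rat_box (f := id) p (@measurable_coord k)).
Qed.

Lemma measurable_fun_coord d (T : measurableType d) k (f : T -> borelRn k) :
  (forall i, measurable_fun setT (fun t => (f t : 'cV[R]_k) i 0)) ->
  measurable_fun setT f.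
Proof.
move=> mf; apply: (@measurability _ _ T (borelRn k) setT f
  (@open 'cV[R]_k) (erefl _)).
move=> _ [U oU <-]; rewrite setTI (open_rat_boxE oU) preimage_bigcup.
rewrite bigcup_mkcond.
apply: countable_bigcupT_measurable => // p; case: ifP => // _.
exact: measurable_preimage_rat_box.
Qed.

Lemma measurable_borelRnD d (T : measurableType d) k (f g : T -> borelRn k) :
  measurable_fun setT f -> measurable_fun setT g ->
  measurable_fun setT
    (fun t => (f t : 'cV[R]_k) + (g t : 'cV[R]_k) : borelRn k).
Proof.
move=> mf mg; apply: measurable_fun_coord => i; under eq_fun do rewrite mxE.
by apply: measurable_funD; apply: measurableT_comp (measurable_coord i) _.
Qed.

Lemma measurable_borelRn_mulmx d (T : measurableType d) j k (A : 'M[R]_(j, k))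
    (f : T -> borelRn k) :
  measurable_fun setT f ->
  measurable_fun setT (fun t => A *m (f t : 'cV[R]_k) : borelRn j).
Proof. by move=> mf; exact: (measurableT_comp (measurable_linmap A) mf). Qed.

End borel_boxes.

(** * Embedding column vectors in the extended reals, and lsc costs *)

Section borel_code.
Context {R : realType}.

Lemma measurable_countable_family_code d (T : measurableType d) (I : countType)
    (F : I -> set T) : (forall i, measurable (F i)) ->
  exists (e : T -> \bar R) (W : I -> set (\bar R)),
    [/\ measurable_fun setT e, forall i, measurable (W i) &
        forall i, e @^-1` (W i) = F i].
Proof.
move=> mF; have [|e [W [me mW eW]]] := @measurable_family_code R _ _
    (fun n => if unpickle n is Some i then F i else set0).
  by move=> n; case: unpickle.
exists e, (W \o pickle); split => // i; first exact: mW.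
by rewrite eW pickleK.
Qed.

Lemma ereal_sup_rat_lt (y : R) :
  ereal_sup [set (ratr q)%:E | q in [set q : rat | ratr q < y]] = y%:E.
Proof.
apply/eqP; rewrite eq_le; apply/andP; split.
  by apply: ge_ereal_sup => _ [q /= qy <-]; rewrite lee_fin ltW.
rewrite leNgt; apply/negP => supy.
set s := ereal_sup _ in supy.
have qs (q : rat) : ratr q < y -> ((ratr q)%:E <= s)%E.
  by move=> qy; apply: ereal_sup_ubound; exists q.
move: supy qs; case: s => [s| |] // sy qs.
  move: sy; rewrite lte_fin => /rat_in_itvoo[q].
  rewrite in_itv/= => /andP[sq /qs]; rewrite lee_fin => qles.
  by have := lt_le_trans sq qles; rewrite ltxx.
have [r [_ /(_ 0%N) ry _]] := rat_seq_below y.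
by have := qs _ ry; rewrite leeNy_eq.
Qed.

(** Coding the half-spaces [ratr q < y i] suffices: the coordinate [y i] is the
    supremum of the rationals [q] whose digit is 1. *)
Lemma borelRn_code k : exists (e : borelRn (R := R) k -> \bar R)
    (dec : \bar R -> borelRn (R := R) k),
  [/\ measurable_fun setT e, measurable_fun setT dec & cancel e dec].
Proof.
have [[i q]|e [W [me mW eW]]] := @measurable_countable_family_code _
    (borelRn k) ('I_k * rat)%type
    (fun p => [set y : borelRn k | ratr p.2 < (y : 'cV[R]_k) p.1 0]).
  exact: (measurable_set_ltr (measurable_cst (ratr q : R))
    (measurable_coord i)).
pose S (i : 'I_k) x :=
  ereal_sup [set (ratr q : R)%:E | q in [set q : rat | W (i, q) x]].
exists e, (fun x => \col_i fine (S i x)); split => //.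
- apply: measurable_fun_coord => i; under eq_fun do rewrite mxE.
  apply: measurableT_comp; first exact: fine_measurable.
  apply: (measurability (@ErealGenOInfty.G R)).
    exact: ErealGenOInfty.measurableE.
  move=> _ [_ [t ->] <-]; rewrite setTI.
  rewrite (_ : _ @^-1` _ = \bigcup_(q in [set q : rat | t < ratr q]) W (i, q)).
    rewrite bigcup_mkcond; apply: countable_bigcupT_measurable => // q.
    by case: ifP => // _; exact: mW.
  apply/seteqP; split => [x|x [q tq Wq]]; rewrite /= in_itv/= andbT.
    move=> /ereal_sup_gt[_ [q /= Wq <-]]; rewrite lte_fin => tq; by exists q.
  apply: (@lt_le_trans _ _ (ratr q)%:E); first by rewrite lte_fin.
  by apply: ereal_sup_ubound; exists q.
- move=> y; apply/matrixP => i j; rewrite mxE ord1 /S.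
  rewrite (_ : [set q | _] = [set q : rat | ratr q < (y : 'cV[R]_k) i 0]).
    by rewrite ereal_sup_rat_lt.
  by apply/funext => q; have := congr1 (@^~ y) (eW (i, q)).
Qed.

Lemma lsc_open_gt k (c : 'cV[R]_k -> R) (a : R) :
  lower_semicontinuous (EFin \o c) -> open [set x | a < c x].
Proof. by move=> /lower_semicontinuousP/(_ a). Qed.

Lemma lsc_measurable k (c : 'cV[R]_k -> R) :
  lower_semicontinuous (EFin \o c) -> measurable_fun setT (c : borelRn k -> R).
Proof.
move=> lc; apply: (@measurability _ _ (borelRn k) R setT c (@RGenOInfty.G R)).
  exact: RGenOInfty.measurableE.
move=> _ [_ [a ->] <-]; rewrite setTI; apply: sub_sigma_algebra.
rewrite /= (_ : _ @^-1` _ = [set x | a < c x]); first exact: lsc_open_gt.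
by apply/seteqP; split => x /=; rewrite in_itv/= andbT.
Qed.

Lemma lsc_comp_mulmx j k (A : 'M[R]_(j, k)) (c : 'cV[R]_j -> R) :
  lower_semicontinuous (EFin \o c) ->
  lower_semicontinuous (EFin \o (fun y : 'cV[R]_k => c (A *m y))).
Proof.
move=> lc; apply/lower_semicontinuousP => a.
have /continuousP := @continuous_mulmx R j k A.
by move=> /(_ _ (lsc_open_gt (a := a) lc)).
Qed.

End borel_code.

(** * Countable unions of rectangles *)

Section rectangles.
Context d d' (T : measurableType d) (S : measurableType d') (R : realType).
Implicit Types (E : nat -> set T) (F : nat -> set S) (m : set (T * S) -> R).

(** Inclusion-exclusion, as the intersection of a finite union of rectangles
    with a rectangle is again a finite union of as many rectangles. *)
Lemma finitely_additive_rectangles m m' E F n :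
  finitely_additive m -> finitely_additive m' ->
  (forall A B, measurable A -> measurable B -> m (A `*` B) = m' (A `*` B)) ->
  (forall i, measurable (E i)) -> (forall i, measurable (F i)) ->
  m (\big[setU/set0]_(i < n) (E i `*` F i)) =
  m' (\big[setU/set0]_(i < n) (E i `*` F i)).
Proof.
move=> ma ma' mm'; elim: n E F => [|n IH] E F mE mF.
  by rewrite !big_ord0 !finitely_additive0.
have mEF i : measurable (E i `*` F i) by exact: measurableX.
rewrite !big_ord_recr/= !finitely_additiveU//; [|exact: bigsetU_measurable..].
rewrite IH// mm'//; congr (_ - _).
have -> : \big[setU/set0]_(i < n) (E i `*` F i) `&` (E n `*` F n) =
    \big[setU/set0]_(i < n) ((E i `&` E n) `*` (F i `&` F n)).
  by rewrite big_distrl/=; apply: eq_bigr => i _; rewrite setXI.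
by apply: (IH (fun i => E i `&` E n) (fun i => F i `&` F n)) => i;
  exact: measurableI.
Qed.

Definition rectangle_union (A : set (T * S)) := exists E F,
  [/\ forall i, measurable (E i), forall i, measurable (F i) &
      A = \bigcup_i (E i `*` F i)].

Lemma rectangle_union_measurable A : rectangle_union A -> measurable A.
Proof.
move=> [E [F [mE mF ->]]]; apply: bigcupT_measurable => i.
exact: measurableX.
Qed.

Lemma rectangle_union_countable (I : countType) (D : set I) (E : I -> set T)
    (F : I -> set S) :
  (forall i, measurable (E i)) -> (forall i, measurable (F i)) ->
  rectangle_union (\bigcup_(i in D) (E i `*` F i)).
Proof.
move=> mE mF.
pose c n : option I :=
  if unpickle n is Some i then if i \in D then Some i else None else None.
exists (fun n => if c n is Some i then E i else set0).
exists (fun n => if c n is Some i then F i else set0).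
split=> [n|n|]; [by case: c|by case: c|].
apply/seteqP; split => [z [i Di Ez]|z [n _]].
  by exists (pickle i) => //; rewrite /c pickleK mem_set.
rewrite /c; case: unpickle => [i|[]//]; case: ifPn => [/set_mem Di Ez|_ []//].
by exists i.
Qed.

(** Only the probability is continuous from below, so mass can be lost in one
    direction: this is the portmanteau inequality for open sets. *)
Lemma rectangle_union_le (p : probability (T * S)%type R) m A :
  finitely_additive m -> (forall B, 0 <= m B) ->
  (forall (C : set T) (D : set S), measurable C -> measurable D ->
    p (C `*` D) = (m (C `*` D))%:E) ->
  rectangle_union A -> (p A <= (m A)%:E)%E.
Proof.
move=> ma m0 pm rA; have mA := rectangle_union_measurable rA.
case: rA mA => E [F [mE mF ->]] mA.
pose B n := \big[setU/set0]_(i < n.+1) (E i `*` F i).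
have mB n : measurable (B n).
  by apply: bigsetU_measurable => i _; exact: measurableX.
have BE : \bigcup_i (E i `*` F i) = \bigcup_n B n.
  by rewrite /B (bigcup_bigsetU_bigcup (fun i => E i `*` F i)).
have pa : finitely_additive (fun A => fine (p A)).
  by move=> C D mC mD CD; rewrite measureU// fineD// fin_num_measure.
have pB n : p (B n) = (m (B n))%:E.
  rewrite -[LHS]fineK ?fin_num_measure//; congr EFin.
  apply: (finitely_additive_rectangles n.+1 pa ma) => // C D mC mD.
  by rewrite pm.
have : p (B n) @[n --> \oo] --> p (\bigcup_i (E i `*` F i)).
  rewrite BE; apply: (@nondecreasing_cvg_mu _ _ _ p B) => //.
    by rewrite -BE.
  move=> i j ij; apply/subsetPset.
  exact: (@subset_bigsetU _ (fun i => E i `*` F i)).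
move=> /cvge_to_le; apply; apply: nearW => n; rewrite pB lee_fin.
apply: finitely_additive_le => //.
by rewrite BE; exact: bigcup_sup.
Qed.

End rectangles.

(** * Lower semicontinuity of the cost along an ultrafilter *)

Section ultralimit.
Context d (T : measurableType d) (R : realType).
Variables (U : set_system nat) (UU : UltraFilter U).
Variable g : nat -> probability T R.

(** Truncation at 1 has no effect on measurable sets; it makes the limit exist
    for all sets. *)
Definition ultralimit (A : set T) : R :=
  lim (Num.min 1 (fine (g k A)) @[k --> U]).

Let PU : ProperFilter U := ultra_proper.

Lemma ultralimit_is_cvg A :
  Num.min 1 (fine (g k A)) @[k --> U] --> ultralimit A.
Proof.
have : cvg (Num.min 1 (fine (g k A)) @[k --> U]).
  apply: ultra_cvg01 => k.
  by rewrite le_min ler01 fine_ge0//= ge_min lexx.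
exact.
Qed.

Lemma ultralimit_cvg A : measurable A ->
  fine (g k A) @[k --> U] --> ultralimit A.
Proof.
move=> mA.
rewrite (_ : (fun k => fine (g k A)) = (fun k => Num.min 1 (fine (g k A)))).
  exact: ultralimit_is_cvg.
apply/funext => k; apply/esym/min_idPr.
by rewrite -lee_fin fineK ?fin_num_measure// probability_le1.
Qed.

Lemma ultralimit_ge0 A : 0 <= ultralimit A.
Proof.
apply: (cvgr_to_ge (@ultralimit_is_cvg A)); apply: (@filterE _ U) => k.
by rewrite le_min ler01 fine_ge0.
Qed.

Lemma ultralimit_additive : finitely_additive ultralimit.
Proof.
move=> A B mA mB AB.
have := ultralimit_cvg (measurableU _ _ mA mB).
under eq_fun do rewrite measureU// fineD ?fin_num_measure//.
move=> h; apply: (cvg_unique _ h) => //.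
by apply: cvgD; exact: ultralimit_cvg.
Qed.

Lemma ultralimit_cst A (a : R) : measurable A -> (forall k, g k A = a%:E) ->
  ultralimit A = a.
Proof.
move=> mA gA; have := ultralimit_cvg mA; under eq_fun do rewrite gA.
by move=> h; apply: (cvg_unique _ h) => //; exact: cvg_cst.
Qed.

End ultralimit.

Section staircase.
Variable R : realType.

(** A discrete layer cake: it approximates [x] from below and involves only the
    strict inequalities [t < x], so that the level sets of a lower
    semicontinuous function enter it as open sets. *)
Definition staircase (a : R) n (x : R) : R :=
  \sum_(j < n) a * (j.+1%:R * a < x)%R%:R.

Lemma staircaseP (a : R) n x : 0 < a -> 0 <= x ->
  (n%:R * a < x -> staircase a n x = n%:R * a) /\
  (x <= n%:R * a -> x - a <= staircase a n x <= x).
Proof.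
move=> a0 x0; rewrite /staircase; elim: n => [|n [IH1 IH2]].
  rewrite big_ord0 mul0r; split => // xle0.
  by rewrite x0 andbT lerBlDr add0r (le_trans xle0 (ltW a0)).
have na : n.+1%:R * a = n%:R * a + a by rewrite -natr1 mulrDl mul1r.
rewrite big_ord_recr/=; split => [nx|xn].
  rewrite nx mulr1 IH1 -?na//; apply: lt_trans nx.
  by rewrite na ltrDl.
rewrite ltNge xn mulr0 addr0.
have [nx|/IH2//] := ltP (n%:R * a) x.
by rewrite IH1// lerBlDr -na xn ltW.
Qed.

Lemma staircase_le (a : R) n x : 0 < a -> 0 <= x -> staircase a n x <= x.
Proof.
move=> a0 x0; have [h1 h2] := staircaseP n a0 x0.
by have [nx|/h2/andP[]//] := ltP (n%:R * a) x; rewrite h1// ltW.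
Qed.

Lemma staircase_ge0 (a : R) n x : 0 <= a -> 0 <= staircase a n x.
Proof. by move=> a0; apply: sumr_ge0 => j _; rewrite mulr_ge0. Qed.

End staircase.

Section lower_semicontinuity.
Context d (T : measurableType d) (R : realType).
Variable h : T -> R.
Hypotheses (mh : measurable_fun setT h) (h0 : forall z, 0 <= h z).

Let mgt t : measurable [set z | t < h z].
Proof. exact: (measurable_set_ltr (measurable_cst t) mh). Qed.

Lemma measurable_staircase (a : R) n : measurable_fun setT (staircase a n \o h).
Proof.
apply: measurable_sum => j; apply: measurable_funM => //.
rewrite (_ : (fun z => _) = \1_[set z | j.+1%:R * a < h z]).
  exact: measurable_indic.
by apply/funext => z; rewrite indicE mem_setE.
Qed.

Lemma integral_staircase (q : probability T R) (a : R) n : 0 < a ->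
  (\int[q]_z (staircase a n (h z))%:E =
   (\sum_(j < n) a * fine (q [set z | (j.+1%:R * a < h z)%R]))%:E)%E.
Proof.
move=> a0; pose A j := [set z | j.+1%:R * a < h z].
have stairE z :
    (staircase a n (h z))%:E = (\sum_(j < n) a%:E * (\1_(A j) z)%:E)%E.
  rewrite /staircase -sumEFin; apply: eq_bigr => j _.
  by rewrite -EFinM indicE mem_setE.
have m1 j : measurable_fun setT (EFin \o (\1_(A j) : T -> R)).
  by apply/measurable_EFinP; apply: measurable_indic; exact: mgt.
under eq_integral do rewrite stairE.
rewrite ge0_integral_sum//; last 2 first.
- by move=> j; apply: emeasurable_funM => //; exact: m1.
- by move=> j z _; rewrite -EFinM lee_fin mulr_ge0// ?ltW// indicE.
rewrite -sumEFin; apply: eq_bigr => j _.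
rewrite ge0_integralZl//; last 2 first.
- exact: m1.
- by rewrite lee_fin ltW.
rewrite integral_indic ?setIT//; last exact: mgt.
by rewrite EFinM fineK ?fin_num_measure//; exact: mgt.
Qed.

(** The integral of a staircase is a finite combination of measures of level
    sets, hence passes to the limit along [U]; Fatou's lemma, which holds for
    sequences but not for limits along ultrafilters, then removes the
    discretization. *)
Lemma integral_le_ultralimit (U : set_system nat) (g : nat -> probability T R)
    (p : probability T R) (eps : R) (delta : nat -> R) : UltraFilter U ->
  (forall t, (p [set z | (t < h z)%R] <=
    (ultralimit U g [set z | (t < h z)%R])%:E)%E) ->
  (forall k, \int[g k]_z (h z)%:E <= (eps + delta k)%:E)%E ->
  delta @ U --> (0 : R) ->
  (\int[p]_z (h z)%:E <= eps%:E)%E.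
Proof.
move=> UU pU gle d0.
have stair_le a n : 0 < a -> (\int[p]_z (staircase a n (h z))%:E <= eps%:E)%E.
  move=> a0; rewrite integral_staircase// lee_fin.
  apply: (@le_trans _ _
    (\sum_(j < n) a * ultralimit U g [set z | j.+1%:R * a < h z])).
    apply: ler_sum => j _; rewrite ler_pM2l//.
    by rewrite -lee_fin fineK ?fin_num_measure.
  have c1 :
      \sum_(j < n) a * fine (g k [set z | j.+1%:R * a < h z]) @[k --> U] -->
      \sum_(j < n) a * ultralimit U g [set z | j.+1%:R * a < h z].
    apply: (cvg_big (@add_continuous R^o) _) => j _.
    by apply: cvgMl_tmp; exact: ultralimit_cvg.
  have c2 : eps + delta k @[k --> U] --> eps.
    by rewrite -[X in _ --> X]addr0; apply: cvgD => //; exact: cvg_cst.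
  apply: (ler_cvg_to c1 c2); apply: (@filterE _ U) => k.
  rewrite -lee_fin -integral_staircase//; apply: le_trans (gle k).
  apply: ge0_le_integral => //.
  - by move=> z _; rewrite lee_fin staircase_ge0// ltW.
  - by apply/measurable_EFinP; exact: measurable_staircase.
  - by apply/measurable_EFinP.
  - by move=> z _; rewrite lee_fin staircase_le.
(* steps of size 1/(n+1) up to height n+1 *)
pose a n : R := n.+1%:R^-1.
pose s n z := (staircase (a n) (n.+1 ^ 2) (h z))%:E.
have a0 n : 0 < a n by rewrite invr_gt0.
have scvg z : s n z @[n --> \oo] --> (h z)%:E.
  apply/cvg_EFin; first by near=> n.
  apply: (@squeeze_cvgr _ _ _ _ (fun n => h z - a n) (cst (h z))); last 2 first.
  - have := cvgB (cvg_cst (h z)) (@cvg_harmonic R).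
    by move=> /(_ _ _); rewrite subr0; exact.
  - exact: cvg_cst.
  near=> n; have [_] := staircaseP (n.+1 ^ 2) (a0 n) (h0 z); apply.
  rewrite /a natrX expr2 mulfK// (@le_trans _ _ n%:R) ?ler_nat//.
  by near: n; exact: nbhs_infty_ger.
under eq_integral do rewrite -(cvg_limn_einf_sup (scvg _)).1.
apply: le_trans (fatou _ _ _ _) _ => //.
- by move=> n; apply/measurable_EFinP; exact: measurable_staircase.
- by move=> n z _; rewrite lee_fin staircase_ge0// ltW.
rewrite limn_einf_lim; apply: lime_le; first exact: is_cvg_einfs.
apply: nearW => n; apply: le_trans (stair_le (a n) (n.+1 ^ 2)%N (a0 n)).
by apply: ereal_inf_lbound; exists n => /=.
Unshelve. all: by end_near. Qed.

End lower_semicontinuity.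

(** * Images of product laws *)

Section laws.
Context d d' (T : measurableType d) (S : measurableType d') (R : realType).

Lemma image_law (P : probability T R) (f : T -> S) : measurable_fun setT f ->
  exists Q : probability S R,
    (forall B, Q B = P (f @^-1` B)) /\
    (forall h : S -> \bar R, measurable_fun setT h -> (forall y, 0 <= h y)%E ->
      (\int[Q]_y h y = \int[P]_x h (f x))%E).
Proof.
move=> mf; pose F : {mfun T >-> S} := mfun_Sub (mem_set mf : f \in mfun).
exists (distribution P F); split => // h mh h0.
by rewrite ge0_integral_distribution.
Qed.

End laws.

Section product_laws.
Context d d' d1 (T : measurableType d) (S : measurableType d')
  (V : measurableType d1) (R : realType).

Lemma product_measure_map (P : probability T R) (Q : probability S R)
    (N : probability V R) (f : T -> S) :
  measurable_fun setT f -> (forall B, measurable B -> Q B = P (f @^-1` B)) ->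
  forall X, measurable X ->
    (Q \x N)%E X = (P \x N)%E [set z | X (f z.1, z.2)].
Proof.
move=> mf QP X mX.
have mfN : measurable_fun setT (fun z : T * V => (f z.1, z.2)).
  by apply: measurable_fun_pair => //; exact: measurableT_comp.
have [nu nuE] := pushforward_is_measure (P \x N)%E mfN.
rewrite (product_measure_unique (m' := nu))//= => A B mA mB.
rewrite nuE QP//.
transitivity ((P \x N)%E ((f @^-1` A) `*` B)).
  by congr (_ _); apply/seteqP; split => z.
apply: product_measure1E => //.
exact: measurable_preimage.
Qed.

Lemma ultralimit_coupling (U : set_system nat) (UU : UltraFilter U)
    (g : nat -> probability (T * S)%type R) (P : probability T R)
    (Q : probability S R) :
  (forall k E, measurable E -> g k (E `*` setT) = P E) ->
  (forall k F, measurable F -> g k (setT `*` F) = Q F) ->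
  finitely_additive_coupling P Q (fun E F => ultralimit U g (E `*` F)).
Proof.
move=> gP gQ; split.
- by move=> E F; exact: ultralimit_ge0.
- move=> F mF A B mA mB AB.
  rewrite -ultralimit_additive//; [|exact: measurableX..|].
    by congr ultralimit; apply/seteqP; split => z /=; tauto.
  by rewrite -setXI AB set0X.
- move=> E mE A B mA mB AB.
  rewrite -ultralimit_additive//; [|exact: measurableX..|].
    by congr ultralimit; apply/seteqP; split => z /=; tauto.
  by rewrite -setXI AB setX0.
- move=> E mE; rewrite (@ultralimit_cst _ _ _ _ _ _ _ (fine (P E)))//.
  + by rewrite fineK// fin_num_measure.
  + exact: measurableX.
  + by move=> k; rewrite gP// fineK// fin_num_measure.
- move=> E mE; rewrite (@ultralimit_cst _ _ _ _ _ _ _ (fine (Q E)))//.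
  + by rewrite fineK// fin_num_measure.
  + exact: measurableX.
  + by move=> k; rewrite gQ// fineK// fin_num_measure.
Qed.

End product_laws.

(** * Transportation costs under linear maps *)

Section pushed_costs.
Context {R : realType}.

Lemma pushE j k (B : 'M[R]_(j, k)) (P : probability (borelRn k) R) S :
  push B P S = P (linmap B @^-1` S).
Proof. by []. Qed.

Lemma push_mulmx i j k (A : 'M[R]_(i, j)) (B : 'M[R]_(j, k))
    (P : probability (borelRn k) R) :
  measure_eq (push A (push B P)) (push (A *m B) P).
Proof.
move=> S mS.
have ABE : linmap A \o linmap B = linmap (A *m B) :> (borelRn k -> borelRn i).
  by apply/funext => x; rewrite /linmap/= mulmxA.
change (P ((linmap A \o linmap B) @^-1` S) = P (linmap (A *m B) @^-1` S)).
by rewrite ABE.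
Qed.

Lemma couplings_measure_eq k (P P' Q Q' : probability (borelRn k) R) :
  measure_eq P P' -> measure_eq Q Q' -> couplings P Q `<=` couplings P' Q'.
Proof.
move=> PP QQ gamma gPQ B mB; have [-> ->] := gPQ B mB.
by split; [exact: PP|exact: QQ].
Qed.

Lemma ot_cost_measure_eq k (c : 'cV[R]_k -> R)
    (P P' Q Q' : probability (borelRn k) R) :
  measure_eq P P' -> measure_eq Q Q' -> ot_cost c P Q = ot_cost c P' Q'.
Proof.
move=> PP QQ; congr ereal_inf; congr image.
apply/seteqP; split; apply: couplings_measure_eq => //.
  by move=> S mS; rewrite PP.
by move=> S mS; rewrite QQ.
Qed.

Lemma measurable_cost_diff k (c : 'cV[R]_k -> R) :
  measurable_fun setT (c : borelRn k -> R) ->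
  measurable_fun setT (fun z : (borelRn k * borelRn k)%type =>
    c ((z.1 : 'cV[R]_k) - (z.2 : 'cV[R]_k))).
Proof.
move=> mc.
have md : measurable_fun setT (fun z : (borelRn k * borelRn k)%type =>
    (z.1 : 'cV[R]_k) - (z.2 : 'cV[R]_k) : borelRn k).
  apply: measurable_fun_coord => i; under eq_fun do rewrite !mxE.
  apply: measurable_funB.
    exact: (measurableT_comp (measurable_coord i) measurable_fst).
  exact: (measurableT_comp (measurable_coord i) measurable_snd).
exact: (measurableT_comp mc md).
Qed.

(** Every coupling of [P] and [Q] is pushed forward by [B] on both factors,
    which does not increase the cost. *)
Lemma ot_cost_push_le j k (B : 'M[R]_(j, k)) (c : 'cV[R]_k -> R)
    (c' : 'cV[R]_j -> R) (P Q : probability (borelRn k) R) :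
  measurable_fun setT (c : borelRn k -> R) ->
  measurable_fun setT (c' : borelRn j -> R) ->
  (forall y, 0 <= c' y) -> (forall x, c' (B *m x) <= c x) ->
  (ot_cost c' (push B P) (push B Q) <= ot_cost c P Q)%E.
Proof.
move=> mc mc' c'0 c'c; have c0 x : 0 <= c x by exact: le_trans (c'0 _) (c'c x).
apply/ereal_infP => _ [gamma gPQ <-].
pose f (z : (borelRn k * borelRn k)%type) : (borelRn j * borelRn j)%type :=
  (linmap B z.1, linmap B z.2).
have mf : measurable_fun setT f.
  by apply: measurable_fun_pair; apply: measurableT_comp => //;
    exact: measurable_linmap.
have [gamma' [g'E g'I]] := image_law gamma mf.
apply: ge_ereal_inf.
exists (\int[gamma']_z (c' ((z.1 : 'cV[R]_j) - (z.2 : 'cV[R]_j)))%:E)%E.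
  exists gamma' => // S mS.
  have mBS : measurable (linmap B @^-1` S).
    exact: measurable_preimage (measurable_linmap B) mS.
  have [g1 g2] := gPQ _ mBS.
  by rewrite /pushforward !g'E !pushE -g1 -g2.
rewrite g'I; last 2 first.
  by apply/measurable_EFinP; exact: measurable_cost_diff.
  by move=> z; rewrite lee_fin.
apply: ge0_le_integral => //.
- by move=> z _; rewrite lee_fin.
- apply/measurable_EFinP.
  exact: (measurableT_comp (measurable_cost_diff mc') mf).
- by apply/measurable_EFinP; exact: measurable_cost_diff.
- by move=> z _; rewrite lee_fin -mulmxBr.
Qed.

Lemma rectangle_union_open_diff k (O : set 'cV[R]_k) : open O ->
  rectangle_union [set z : (borelRn k * borelRn k)%type |
    O ((z.1 : 'cV[R]_k) - (z.2 : 'cV[R]_k))].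
Proof.
move=> oO.
have oD : open [set z : ('cV[R]_k * 'cV[R]_k)%type | O (z.1 - z.2)].
  have /continuousP := @sub_continuous 'cV[R]_k.
  by move=> /(_ _ oO).
rewrite (open_rat_box2E oD).
by apply: rectangle_union_countable => p; exact: measurable_rat_box.
Qed.

(** A self-adjoint idempotent is an orthogonal projection, so [x - Pi *m x] is
    orthogonal to [Pi *m x]. *)
Lemma orthomonotone_projection n (X Pi : 'M[R]_n) (c : 'cV[R]_n -> R) x :
  sym_posdef X -> orthomonotone X c -> Pi *m Pi = Pi -> adjmx X X Pi = Pi ->
  c (Pi *m x) <= c x.
Proof.
move=> sX oc PiPi PiX.
have {2}-> : x = Pi *m x + (x - Pi *m x) by rewrite addrC subrK.
apply: oc; rewrite -{1}PiX inner_adjmx// mulmxBr mulmxA PiPi subrr.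
by rewrite /inner mulmx0 mxE.
Qed.

End pushed_costs.

(** * Optimal couplings and their lifting *)

Section optimal_couplings.
Context {R : realType}.

(** The infimum defining the cost is attained, by a coupling of the form
    [(x, G (x, u))] with [u] uniform: it is the ultrafilter limit of couplings
    of cost at most [eps + 1/(i+1)]. *)
Lemma ot_cost_randomized_map k (c : 'cV[R]_k -> R) (eps : R)
    (P Q : probability (borelRn k) R) :
  transport_cost c -> (ot_cost c P Q <= eps%:E)%E ->
  exists G : borelRn k * measurableTypeR R -> borelRn k,
    [/\ measurable_fun setT G,
        forall F, measurable F -> Q F = (P \x unif01 R)%E (G @^-1` F) &
        (\int[(P \x unif01 R)%E]_z
          (c ((z.1 : 'cV[R]_k) - (G z : 'cV[R]_k)))%:E <= eps%:E)%E].
Proof.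
move=> [c0 lc] PQ; have mc := lsc_measurable lc.
have /choice[g gP] i : exists gamma, couplings P Q gamma /\
    (\int[gamma]_z (c ((z.1 : 'cV[R]_k) - (z.2 : 'cV[R]_k)))%:E <=
      (eps + i.+1%:R^-1)%:E)%E.
  have : (ot_cost c P Q < (eps + i.+1%:R^-1)%:E)%E.
    by apply: le_lt_trans PQ _; rewrite lte_fin ltrDl invr_gt0.
  by move=> /ereal_inf_lt[_ [gamma gPQ <-]] /ltW; exists gamma.
have [U [UU oU]] := ultraFilterLemma (_ : ProperFilter (\oo : set_system nat)).
have mfac : finitely_additive_coupling P Q
    (fun E F => ultralimit U g (E `*` F)).
  apply: ultralimit_coupling => i E mE; have [/(_ _ mE)[gE1 gE2] _] := gP i.
    by rewrite -gE1; congr (g i _); apply/seteqP; split => z //= [].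
  by rewrite -gE2; congr (g i _); apply/seteqP; split => z //= [].
have [e [dec [me mdec eK]]] := @borelRn_code R k.
have [G mG GE] := randomization mfac me mdec eK.
exists G; split => //.
  move=> F mF; apply: etrans (esym (fac_snd mfac mF)) _.
  apply: etrans (esym (GE setT F measurableT mF)) _.
  congr ((P \x unif01 R)%E _).
  by apply/seteqP; split => z /=; [case|].
have mf : measurable_fun setT
    (fun z : borelRn k * measurableTypeR R => (z.1, G z)).
  exact: measurable_fun_pair.
have [p [pE pI]] := image_law (P \x unif01 R)%E mf.
have mh := measurable_cost_diff mc.
rewrite -[X in (X <= _)%E](pI (fun z =>
  (c ((z.1 : 'cV[R]_k) - (z.2 : 'cV[R]_k)))%:E)); last 2 first.
  by apply/measurable_EFinP.
  by move=> z; rewrite lee_fin.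
apply: (integral_le_ultralimit mh _ UU (g := g)
  (delta := fun i => i.+1%:R^-1)) => [//|t|i|].
- apply: rectangle_union_le.
  + exact: ultralimit_additive.
  + by move=> B; exact: ultralimit_ge0.
  + by move=> E F mE mF; rewrite pE; exact: GE.
  + apply: (rectangle_union_open_diff (O := [set x | t < c x])).
    exact: lsc_open_gt.
- by have [] := gP i.
- by apply: cvg_trans (@cvg_harmonic R) => V; exact: oU.
Qed.

(** The displacement [A *m x - G (A *m x, u)] of the optimal randomized map is
    lifted by [B].  As [G] uses only noise independent of its first argument,
    substituting [A *m x], with [x] of law [P], for that argument glues the
    optimal coupling to [P]. *)
Lemma ot_ball_lift m n (A : 'M[R]_(m, n)) (B : 'M[R]_(n, m)) (c : 'cV[R]_n -> R)
    (eps : R) (P : probability (borelRn n) R) :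
  A *m B = 1%:M -> transport_cost c ->
  ot_ball (fun y => c (B *m y)) eps (push A P) `<=`
  push_set A (ot_ball c eps P).
Proof.
move=> AB [c0 lc] Q' /= PQ.
have mc := lsc_measurable lc.
have [|G [mG Q'E Gle]] := ot_cost_randomized_map _ PQ.
  by split => //; exact: lsc_comp_mulmx.
pose N := unif01 R.
pose aN (z : borelRn n * measurableTypeR R) : borelRn m * measurableTypeR R :=
  (linmap A z.1, z.2).
have maN : measurable_fun setT aN.
  apply: measurable_fun_pair => //.
  exact: (measurableT_comp (measurable_linmap A) measurable_fst).
have PN X : measurable X -> (push A P \x N)%E X = (P \x N)%E (aN @^-1` X).
  exact: (product_measure_map N (measurable_linmap A)).
(* the component of the starting point in the kernel of [A] is not moved *)
pose x2 (z : borelRn n * measurableTypeR R) : borelRn n :=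
  B *m (G (aN z) : 'cV[R]_m) + (1%:M - B *m A) *m (z.1 : 'cV[R]_n).
have mx2 : measurable_fun setT x2.
  apply: measurable_borelRnD; last first.
    exact: measurable_borelRn_mulmx measurable_fst.
  exact: measurable_borelRn_mulmx (measurableT_comp mG maN).
have Ax2 z : linmap A (x2 z) = G (aN z).
  rewrite /linmap /x2 mulmxDr !mulmxA mulmxBr !mulmxA AB mulmx1 !mul1mx.
  by rewrite subrr mul0mx addr0.
have [Q [QE _]] := image_law (P \x N)%E mx2.
have mpair : measurable_fun setT
    (fun z : borelRn n * measurableTypeR R => (z.1, x2 z)).
  exact: measurable_fun_pair.
have [gamma [gE gI]] := image_law (P \x N)%E mpair.
exists Q; last first.
  move=> F mF; rewrite /= Q'E// PN; last exact: measurable_preimage.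
  rewrite [RHS]pushE QE; congr (_ _).
  by apply/seteqP; split => z /=; rewrite Ax2.
apply: ge_ereal_inf.
exists (\int[gamma]_z (c ((z.1 : 'cV[R]_n) - (z.2 : 'cV[R]_n)))%:E)%E.
  exists gamma => // S mS; rewrite /pushforward !gE QE; split => //.
  transitivity ((P \x N)%E (S `*` setT)).
    by congr (_ _); apply/seteqP; split => z //= [].
  rewrite product_measure1E// -[RHS]mule1; congr (_ * _)%E.
  exact: probability_setT.
rewrite gI; last 2 first.
  by apply/measurable_EFinP; exact: measurable_cost_diff.
  by move=> z; rewrite lee_fin.
apply: le_trans Gle.
have [L [LE LI]] := image_law (P \x N)%E maN.
rewrite (eq_measure_integral L); last first.
  by move=> X mX _; exact: etrans (PN X mX) (esym (LE X)).
rewrite LI; last 2 first.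
- apply/measurable_EFinP.
  have mcB : measurable_fun setT ((fun y => c (B *m y)) : borelRn m -> R).
    exact: lsc_measurable (lsc_comp_mulmx lc).
  apply: (measurableT_comp (measurable_cost_diff mcB)
    (_ : measurable_fun setT
      (fun z : borelRn m * measurableTypeR R => (z.1, G z)))).
  exact: measurable_fun_pair.
- by move=> z; rewrite lee_fin.
rewrite le_eqVlt; apply/orP; left; apply/eqP; apply: eq_integral => z _.
congr (c _)%:E; rewrite /x2 /= /linmap mulmxBr mulmxBl mul1mx mulmxA.
by rewrite opprD opprB addrC -addrA subrK addrC.
Qed.

End optimal_couplings.

(** * Inclusions between push-forwards of transport balls *)

Unset Implicit Arguments.
Theorem theorem6 (R : realType) (n m : nat) (X : 'M[R]_n) (Y : 'M[R]_m)
    (hX : sym_posdef X) (hY : sym_posdef Y)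
    (P : probability (borelRn n) R) (A : 'M[R]_(m, n))
    (eps : R) (heps : 0 <= eps)
    (c : 'cV[R]_n -> R) (hc : transport_cost c) (hcX : orthomonotone X c) :
  let Ad := mpinv X Y A in
  let cAd := fun y : 'cV[R]_m => c (Ad *m y) in
  [/\ push_set A (ot_ball c eps P)
        `<=` push_set (A *m Ad) (ot_ball cAd eps (push A P)),
      push_set (A *m Ad) (ot_ball cAd eps (push A P))
        = push_set A (ot_ball c eps (push (Ad *m A) P)),
      push_set A (ot_ball c eps (push (Ad *m A) P))
        `<=` ot_ball cAd eps (push A P) &
      row_free A ->
        [/\ push_set A (ot_ball c eps P)
              = push_set (A *m Ad) (ot_ball cAd eps (push A P)),
            push_set A (ot_ball c eps (push (Ad *m A) P))
              = ot_ball cAd eps (push A P) &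
            push_set A (ot_ball c eps P) = ot_ball cAd eps (push A P)]].
Proof.
move=> Ad cAd; have [c0 lc] := hc.
have [AAdA AdAAd _ AdAX] := mpinvP A hX hY; rewrite -/Ad in AAdA AdAAd AdAX.
have mc : measurable_fun setT (c : borelRn n -> R) := lsc_measurable lc.
have mcAd : measurable_fun setT (cAd : borelRn m -> R).
  exact: lsc_measurable (lsc_comp_mulmx lc).
have cproj x : c (Ad *m A *m x) <= c x.
  by apply: (orthomonotone_projection (X := X)) => //; rewrite mulmxA AdAAd.
have cA x : cAd (A *m x) <= c x by rewrite /cAd mulmxA.
have pushA (Q : probability (borelRn n) R) :
    measure_eq (push (A *m Ad) (push A Q)) (push A Q).
  by move=> S mS; rewrite push_mulmx// AAdA.
have pushAP : measure_eq (push A (push (Ad *m A) P)) (push A P).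
  by move=> S mS; rewrite push_mulmx// mulmxA AAdA.
have ball_push Q : ot_ball c eps (push (Ad *m A) P) Q ->
    ot_ball cAd eps (push A P) (push A Q).
  move=> PQ; apply: le_trans PQ.
  rewrite -(ot_cost_measure_eq cAd pushAP (fun _ _ => erefl)).
  by apply: ot_cost_push_le => // y; exact: c0.
have incl1 : push_set A (ot_ball c eps P)
    `<=` push_set (A *m Ad) (ot_ball cAd eps (push A P)).
  move=> Q' [Q PQ Q'Q]; exists (push A Q).
    by apply: le_trans PQ; apply: ot_cost_push_le => // y; exact: c0.
  by move=> S mS; rewrite Q'Q// pushA.
have eq2 : push_set (A *m Ad) (ot_ball cAd eps (push A P)) =
    push_set A (ot_ball c eps (push (Ad *m A) P)).
  apply/seteqP; split => Q' [Q PQ Q'Q].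
    exists (push Ad Q); last by move=> S mS; rewrite Q'Q// push_mulmx.
    apply: le_trans PQ.
    rewrite -(ot_cost_measure_eq c (push_mulmx Ad A P) (fun _ _ => erefl)).
    by apply: ot_cost_push_le.
  exists (push A Q); first exact: ball_push.
  by move=> S mS; rewrite Q'Q// pushA.
have incl3 : push_set A (ot_ball c eps (push (Ad *m A) P)) `<=`
    ot_ball cAd eps (push A P).
  move=> Q' [Q /ball_push PQ Q'Q]; rewrite /ot_ball/=.
  by rewrite (ot_cost_measure_eq cAd (fun _ _ => erefl) Q'Q).
split => // Afree.
have AAd1 : A *m Ad = 1%:M.
  by apply: (row_free_inj Afree); rewrite AAdA mul1mx.
have incl4 : ot_ball cAd eps (push A P) `<=` push_set A (ot_ball c eps P).
  exact: ot_ball_lift.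
split.
- by apply/seteqP; split => //; rewrite eq2; exact: subset_trans incl4.
- apply/seteqP; split => //; rewrite -eq2; exact: subset_trans incl1.
- apply/seteqP; split => //; apply: subset_trans incl1 _.
  by rewrite eq2; exact: incl3.
Qed.
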